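(* $\mathsf{BIM}\vdash\mathbf{OI}([0,1])\rightarrow\mathbf{HB}$, where $\mathbf{OI}([0,1])$: for every $\alpha$, if for every $\gamma\in[0,1]$ [every real $\delta$ with $0\le_{\mathcal R}\delta<_{\mathcal R}\gamma$ lies in $\mathcal H_\alpha$ implies $\gamma\in\mathcal H_\alpha$], then $[0,1]\subseteq\mathcal H_\alpha$; and $\mathbf{HB}$ (Heine–Borel): for every $\alpha$, if $[0,1]\subseteq\mathcal H_\alpha$ then there is $m$ with $[0,1]\subseteq\mathcal H_{\overline\alpha m}$.
   Context: $\mathsf{BIM}$ is the two-sorted intuitionistic theory of natural numbers and functions $\mathbb N\to\mathbb N$ with extensionality, primitive recursive constants, closure of functions under composition, primitive recursion and unbounded search, and full induction. Finite sequences are coded by naturals; $\overline\alpha m$ is the code of $\langle\alpha(0),\dots,\alpha(m-1)\rangle$, and for a code $t$, $t(i)$ is its $i$-th entry. Reals: a rational segment is a pair $(s',s'')$ of rationals with $s'<s''$, $s\sqsubset_{\mathbb S}t$ iff $t'<s'<s''<t''$. $\mathcal R$ is the set of $x$ with each $x(n)$ a rational segment, $x(n+1)\sqsubset_{\mathbb S}x(n)$ and lengths of $x(n)$ tending to $0$ ($\forall m\exists n$ length $<2^{-m}$). $x<_{\mathcal R}y$ iff for some $n$ the right endpoint of $x(n)$ is below the left endpoint of $y(n)$; $x\le_{\mathcal R}y$ iff $\neg(y<_{\mathcal R}x)$; $[0,1]=\{x\mid0\le_{\mathcal R}x\le_{\mathcal R}1\}$. For $\alpha\in\mathbb N^{\mathbb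 N}$, $\mathcal H_\alpha$ is the set of reals $x$ such that there exist $n$ and a code $s$ of a rational segment with $\alpha(s)\ne0$ and $x(n)\sqsubset_{\mathbb S}s$; for a code $t$ of a finite sequence, $\mathcal H_t$ is the set of reals $x$ such that there exist $n$ and a code $s<length(t)$ of a rational segment with $t(s)\ne0$ and $x(n)\sqsubset_{\mathbb S}s$. *)

(* Defs.v *)
(** The formal system BIM as a deductive calculus, and the sentences OI([0,1])
    and HB of its language. *)
From Stdlib Require Import List.
Import ListNotations.

(** * Language

    Functions of several arguments are unary functions on values of the pairing
    symbol [nJ], with projections [cK] and [cL].  The remaining constants name
    all primitive recursive functions: Kleene's generation of the unary ones from
    initial functions by pairing, composition and recursion with a parameter.
    Of [nJ], [cK], [cL] the axioms only say that they form a bijective pairing. *)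

Inductive con : Set :=
| cZero | cId | cSucc | cK | cL
| cPair (c d : con)
| cComp (c d : con)
| cRec (c d : con).

(** Two sorts of de Bruijn indices, counted separately: [nvar] for numbers and
    [fvar] for functions.  A function term contains no number variable, hence is
    unaffected by number quantifiers. *)

Inductive fn : Set :=
| fvar (i : nat)
| fcon (c : con).

Inductive num : Set :=
| nvar (i : nat)
| nO
| nJ (t u : num)
| napp (f : fn) (t : num).

Coercion fcon : con >-> fn.
Coercion napp : fn >-> Funclass.

Inductive form : Set :=
| fEq0 (t u : num)
| fEq1 (f g : fn)
| fBot
| fAnd (A B : form)
| fOr (A B : form)
| fImp (A B : form)
| fAll0 (A : form)
| fEx0 (A : form)
| fAll1 (A : form)
| fEx1 (A : form).

Declare Scope bim_scope.
Delimit Scope bim_scope with bim.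
Bind Scope bim_scope with form.
Notation "t == u" := (fEq0 t u) (at level 70, no associativity) : bim_scope.
Notation "f === g" := (fEq1 f g) (at level 70, no associativity) : bim_scope.
Notation "A /\ B" := (fAnd A B) : bim_scope.
Notation "A \/ B" := (fOr A B) : bim_scope.
Notation "A ==> B" := (fImp A B) (at level 99, right associativity) : bim_scope.
Notation "~ A" := (fImp A fBot) : bim_scope.
Local Open Scope bim_scope.

(** * Substitution *)

Definition fn_subst (sf : nat -> fn) (f : fn) : fn :=
  match f with fvar i => sf i | fcon c => fcon c end.

Fixpoint num_subst (sn : nat -> num) (sf : nat -> fn) (t : num) : num :=
  match t with
  | nvar i => sn i
  | nO => nO
  | nJ t u => nJ (num_subst sn sf t) (num_subst sn sf u)
  | napp f t => napp (fn_subst sf f) (num_subst sn sf t)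
  end.

Definition nshift0 : num -> num := num_subst (fun i => nvar (S i)) fvar.
Definition nshift1 : num -> num := num_subst nvar (fun i => fvar (S i)).
Definition fshift1 : fn -> fn := fn_subst (fun i => fvar (S i)).

Definition up0 (sn : nat -> num) (i : nat) : num :=
  match i with O => nvar 0 | S j => nshift0 (sn j) end.
Definition up1 (sf : nat -> fn) (i : nat) : fn :=
  match i with O => fvar 0 | S j => fshift1 (sf j) end.

Fixpoint form_subst (sn : nat -> num) (sf : nat -> fn) (A : form) : form :=
  match A with
  | fEq0 t u => fEq0 (num_subst sn sf t) (num_subst sn sf u)
  | fEq1 f g => fEq1 (fn_subst sf f) (fn_subst sf g)
  | fBot => fBot
  | fAnd A B => fAnd (form_subst sn sf A) (form_subst sn sf B)
  | fOr A B => fOr (form_subst sn sf A) (form_subst sn sf B)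
  | fImp A B => fImp (form_subst sn sf A) (form_subst sn sf B)
  | fAll0 A => fAll0 (form_subst (up0 sn) sf A)
  | fEx0 A => fEx0 (form_subst (up0 sn) sf A)
  | fAll1 A => fAll1 (form_subst (fun i => nshift1 (sn i)) (up1 sf) A)
  | fEx1 A => fEx1 (form_subst (fun i => nshift1 (sn i)) (up1 sf) A)
  end.

Definition shift0 : form -> form := form_subst (fun i => nvar (S i)) fvar.
Definition shift1 : form -> form := form_subst nvar (fun i => fvar (S i)).

(** [inst0 A t] and [inst1 A f] are the instances of [fAll0 A] at [t] and of
    [fAll1 A] at [f]. *)
Definition inst0 (A : form) (t : num) : form :=
  form_subst (fun i => match i with O => t | S j => nvar j end) fvar A.
Definition inst1 (A : form) (f : fn) : form :=
  form_subst nvar (fun i => match i with O => f | S j => fvar j end) A.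

(** For [A] read as A(n), n being [nvar 0]: the formula A(S(n)). *)
Definition at_succ (A : form) : form :=
  form_subst (fun i => match i with O => cSucc (nvar 0) | S j => nvar (S j) end)
    fvar A.

(** * Primitive recursive terms *)

Definition num1 : num := cSucc nO.

Definition cAdd : con := cRec cId (cComp cSucc cL).
Definition nadd (t u : num) : num := cAdd (nJ t u).

(** mul(m,n+1) = m + mul(m,n); the step acts on J(J(m,n),mul(m,n)). *)
Definition cMul : con :=
  cRec cZero (cComp cAdd (cPair (cComp cK cK) cL)).
Definition nmul (t u : num) : num := cMul (nJ t u).

Definition fLt (t u : num) : form :=
  fEx0 (nadd (nshift0 t) (cSucc (nvar 0)) == nshift0 u).

(** * Axioms

    Formulas with free variables stand for their universal closures. *)

Inductive axiom : form -> Prop :=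
(* equality *)
| ax_refl0 t : axiom (t == t)
| ax_refl1 f : axiom (f === f)
| ax_leibniz0 A t u : axiom (t == u ==> inst0 A t ==> inst0 A u)
| ax_leibniz1 A f g : axiom (f === g ==> inst1 A f ==> inst1 A g)
(* extensionality *)
| ax_ext : axiom (fAll1 (fAll1
    (let a := fvar 1 in let b := fvar 0 in let n := nvar 0 in
     (a === b ==> fAll0 (a n == b n)) /\ (fAll0 (a n == b n) ==> a === b))))
(* constants *)
| ax_succ_neq0 : axiom (fAll0 (~ (cSucc (nvar 0) == nO)))
| ax_succ_inj : axiom (fAll0 (fAll0
    (cSucc (nvar 1) == cSucc (nvar 0) ==> nvar 1 == nvar 0)))
| ax_KJ : axiom (fAll0 (fAll0 (cK (nJ (nvar 1) (nvar 0)) == nvar 1)))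
| ax_LJ : axiom (fAll0 (fAll0 (cL (nJ (nvar 1) (nvar 0)) == nvar 0)))
| ax_JKL : axiom (fAll0 (nJ (cK (nvar 0)) (cL (nvar 0)) == nvar 0))
| ax_zero : axiom (fAll0 (cZero (nvar 0) == nO))
| ax_id : axiom (fAll0 (cId (nvar 0) == nvar 0))
| ax_pair c d : axiom (fAll0
    (cPair c d (nvar 0) == nJ (c (nvar 0)) (d (nvar 0))))
| ax_comp c d : axiom (fAll0 (cComp c d (nvar 0) == c (d (nvar 0))))
| ax_rec0 c d : axiom (fAll0 (cRec c d (nJ (nvar 0) nO) == c (nvar 0)))
| ax_recS c d : axiom (fAll0 (fAll0
    (let m := nvar 1 in let n := nvar 0 in
     cRec c d (nJ m (cSucc n)) == d (nJ (nJ m n) (cRec c d (nJ m n))))))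
(* closure of the functions under composition, for unary and for binary outer
   functions, under primitive recursion and under unbounded search *)
| ax_cl_comp : axiom (fAll1 (fAll1 (fEx1 (fAll0
    (let a := fvar 2 in let b := fvar 1 in let g := fvar 0 in
     let n := nvar 0 in
     g n == a (b n))))))
| ax_cl_comp2 : axiom (fAll1 (fAll1 (fAll1 (fEx1 (fAll0
    (let a := fvar 3 in let b := fvar 2 in let d := fvar 1 in
     let g := fvar 0 in let n := nvar 0 in
     g n == a (nJ (b n) (d n))))))))
| ax_cl_rec : axiom (fAll1 (fAll1 (fEx1 (fAll0 (fAll0
    (let a := fvar 2 in let b := fvar 1 in let g := fvar 0 in
     let m := nvar 1 in let n := nvar 0 in
     g (nJ m nO) == a m /\
     g (nJ m (cSucc n)) == b (nJ (nJ m n) (g (nJ m n)))))))))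
| ax_cl_search : axiom (fAll1
    (fAll0 (fEx0 (fvar 0 (nJ (nvar 1) (nvar 0)) == nO)) ==>
     fEx1 (fAll0
       (let a := fvar 1 in let g := fvar 0 in let m := nvar 0 in
        a (nJ m (g m)) == nO /\
        fAll0 (let m := nvar 1 in let n := nvar 0 in
          fLt n (g m) ==> ~ (a (nJ m n) == nO))))))
(* full induction *)
| ax_ind A : axiom
    (inst0 A nO ==> fAll0 (A ==> at_succ A) ==> fAll0 A).

(** * Intuitionistic natural deduction *)

Inductive derives : list form -> form -> Prop :=
| d_ax G A : axiom A -> derives G A
| d_hyp G A : In A G -> derives G A
| d_botE G A : derives G fBot -> derives G A
| d_andI G A B : derives G A -> derives G B -> derives G (A /\ B)
| d_andE1 G A B : derives G (A /\ B) -> derives G A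
| d_andE2 G A B : derives G (A /\ B) -> derives G B
| d_orI1 G A B : derives G A -> derives G (A \/ B)
| d_orI2 G A B : derives G B -> derives G (A \/ B)
| d_orE G A B C : derives G (A \/ B) ->
    derives (A :: G) C -> derives (B :: G) C -> derives G C
| d_impI G A B : derives (A :: G) B -> derives G (A ==> B)
| d_impE G A B : derives G (A ==> B) -> derives G A -> derives G B
| d_all0I G A : derives (map shift0 G) A -> derives G (fAll0 A)
| d_all0E G A t : derives G (fAll0 A) -> derives G (inst0 A t)
| d_ex0I G A t : derives G (inst0 A t) -> derives G (fEx0 A)
| d_ex0E G A C : derives G (fEx0 A) ->
    derives (A :: map shift0 G) (shift0 C) -> derives G C
| d_all1I G A : derives (map shift1 G) A -> derives G (fAll1 A)
| d_all1E G A f : derives G (fAll1 A) -> derives G (inst1 A f)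
| d_ex1I G A f : derives G (inst1 A f) -> derives G (fEx1 A)
| d_ex1E G A C : derives G (fEx1 A) ->
    derives (A :: map shift1 G) (shift1 C) -> derives G C.

Definition BIM_proves (A : form) : Prop := derives [] A.

(** * Finite sequences

    <a_0,...,a_(k-1)> is coded by J(k, J(a_0, J(a_1, ... J(a_(k-1), 0)))). *)

(** (b,i) |-> L^i(b) *)
Definition cDrop : con := cRec cId (cComp cL cL).

Definition seq_length (t : num) : num := cK t.
Definition entry (t i : num) : num := cK (cDrop (nJ (cL t) i)).
Definition is_code (t : num) : form := cDrop (nJ (cL t) (seq_length t)) == nO.

(** t is the code of <a(0),...,a(m-1)>, which is not a term of the language. *)
Definition is_initial (a : fn) (m t : num) : form :=
  is_code t /\ seq_length t == m /\
  fAll0 (let i := nvar 0 in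
         fLt i (nshift0 m) ==> entry (nshift0 t) i == a i).

(** * Rationals

    Every natural number codes a rational: J(J(a,b),c) codes (a - b) / (c + 1).
    A rational has several codes; the order respects equality of the rationals. *)

Definition qpos (q : num) : num := cK (cK q).
Definition qneg (q : num) : num := cL (cK q).
Definition qden (q : num) : num := cSucc (cL q).

Definition qlt (q r : num) : form :=
  fLt (nadd (nmul (qpos q) (qden r)) (nmul (qneg r) (qden q)))
      (nadd (nmul (qpos r) (qden q)) (nmul (qneg q) (qden r))).

(** The last component codes the product (c+1)(d+1) of the denominators,
    as cd + (c + d). *)
Definition qsub (q r : num) : num :=
  nJ (nJ (nadd (nmul (qpos q) (qden r)) (nmul (qneg r) (qden q)))
         (nadd (nmul (qneg q) (qden r)) (nmul (qpos r) (qden q))))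
     (nadd (nmul (cL q) (cL r)) (nadd (cL q) (cL r))).

(** n |-> 2^n - 1, from 2^(n+1) - 1 = (2^n - 1) + (2^n - 1) + 1 *)
Definition cPow2Pred : con :=
  cComp (cRec cZero (cComp cSucc (cComp cAdd (cPair cL cL))))
        (cPair cZero cId).

(** 2^(-m) *)
Definition qpow2inv (m : num) : num := nJ (nJ num1 nO) (cPow2Pred m).

(** * Rational segments and reals *)

Definition lo (s : num) : num := cK s.
Definition hi (s : num) : num := cL s.

Definition is_segment (s : num) : form := qlt (lo s) (hi s).

Definition strictly_inside (s t : num) : form :=
  qlt (lo t) (lo s) /\ qlt (lo s) (hi s) /\ qlt (hi s) (hi t).

Definition is_real (x : fn) : form :=
  fAll0 (is_segment (x (nvar 0))) /\
  fAll0 (let n := nvar 0 in strictly_inside (x (cSucc n)) (x n)) /\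
  fAll0 (fEx0 (let m := nvar 1 in let n := nvar 0 in
    qlt (qsub (hi (x n)) (lo (x n))) (qpow2inv m))).

Definition rlt (x y : fn) : form :=
  fEx0 (let n := nvar 0 in qlt (hi (x n)) (lo (y n))).
Definition rle (x y : fn) : form := ~ rlt y x.

(** The rational q as a real is n |-> (q - 2^(-n), q + 2^(-n)). *)
Definition cOne : con := cComp cSucc cZero.
Definition cRat (a b c : con) : con := cPair (cPair a b) c.
Definition real0 : fn :=
  cPair (cRat cZero cOne cPow2Pred) (cRat cOne cZero cPow2Pred).
Definition real1 : fn :=
  cPair (cRat cPow2Pred cZero cPow2Pred)
        (cRat (cComp cSucc (cComp cSucc cPow2Pred)) cZero cPow2Pred).

Definition in_unit (x : fn) : form :=
  is_real x /\ rle real0 x /\ rle x real1.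

(** * The open sets H_a and H_t, open induction and Heine-Borel *)

Definition in_H (a x : fn) : form :=
  is_real x /\
  fEx0 (fEx0 (let n := nvar 1 in let s := nvar 0 in
    is_segment s /\ ~ (a s == nO) /\ strictly_inside (x n) s)).

Definition in_Hfin (t : num) (x : fn) : form :=
  is_real x /\
  fEx0 (fEx0 (let n := nvar 1 in let s := nvar 0 in
    let t' := nshift0 (nshift0 t) in
    fLt s (seq_length t') /\ is_segment s /\ ~ (entry t' s == nO) /\
    strictly_inside (x n) s)).

Definition unit_sub_H (a : fn) : form :=
  fAll1 (in_unit (fvar 0) ==> in_H (fshift1 a) (fvar 0)).
Definition unit_sub_Hfin (t : num) : form :=
  fAll1 (in_unit (fvar 0) ==> in_Hfin (nshift1 t) (fvar 0)).

Definition OI : form :=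
  fAll1 (
    fAll1 (let a := fvar 1 in let g := fvar 0 in
      in_unit g ==>
      fAll1 (let a := fvar 2 in let g := fvar 1 in let d := fvar 0 in
        is_real d ==> rle real0 d ==> rlt d g ==> in_H a d) ==>
      in_H a g)
    ==> unit_sub_H (fvar 0)).

Definition HB : form :=
  fAll1 (let a := fvar 0 in
    unit_sub_H a ==>
    fEx0 (fEx0 (let m := nvar 1 in let t := nvar 0 in
      is_initial a m t /\ unit_sub_Hfin t))).

(* Main.v *)
(** A rational chain from 0 is a list of segments enumerated by [a], the first with
    negative left end and each later one with left end below the right end of its
    predecessor.  A finite chain covers [[0,q]] for every rational [q] below its last
    right end, because a real can be compared with two rationals [q < r]: it lies
    above [q] or below [r].  The set of reals that lie below the right end of some
    chain is open, but "some chain" is an unbounded existential quantifier, while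
    OI needs this set in the form [in_H b] for a function [b].  As every rational has
    infinitely many codes, the chain can be hidden in the code of the left end of a
    segment, where [b] finds it, and [b] becomes primitive recursive in [a].  This set
    is progressive: if it contains all reals in [[0,c)] and [c] lies in a segment [e]
    enumerated by [a], a chain passes the left end of [e] and is prolonged by [e].
    Open induction puts 1 into it, and the chain found there is a finite cover.

    Derivability in a context [G] is handled as forcing: hypotheses about terms of
    the calculus are statements [derives G A], and opening an assumption or a
    witness passes to a larger context. *)

From Stdlib Require Morphisms.
From Stdlib Require Import List PeanoNat Lia RelationClasses Ring
  FunctionalExtensionality.
Require Import Defs.
Import ListNotations.

(** * Substitution *)

Lemma fn_subst_id f : fn_subst fvar f = f.
Proof. now destruct f. Qed.

Lemma fn_subst_subst s2 s1 f :
  fn_subst s2 (fn_subst s1 f) = fn_subst (fun i => fn_subst s2 (s1 i)) f.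
Proof. now destruct f. Qed.

Lemma num_subst_id t : num_subst nvar fvar t = t.
Proof.
  induction t; simpl; rewrite ?fn_subst_id; congruence.
Qed.

Lemma num_subst_subst n2 s2 n1 s1 t :
  num_subst n2 s2 (num_subst n1 s1 t) =
  num_subst (fun i => num_subst n2 s2 (n1 i)) (fun i => fn_subst s2 (s1 i)) t.
Proof.
  induction t; simpl; rewrite ?fn_subst_subst; congruence.
Qed.

Lemma up0_shift n s t :
  num_subst (up0 n) s (nshift0 t) = nshift0 (num_subst n s t).
Proof.
  unfold nshift0. rewrite !num_subst_subst. f_equal.
  extensionality i. symmetry. apply fn_subst_id.
Qed.

Lemma up1_fshift s f : fn_subst (up1 s) (fshift1 f) = fshift1 (fn_subst s f).
Proof. unfold fshift1. now rewrite !fn_subst_subst. Qed.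

Lemma up1_shift n s t :
  num_subst (fun i => nshift1 (n i)) (up1 s) (nshift1 t) =
  nshift1 (num_subst n s t).
Proof. unfold nshift1. now rewrite !num_subst_subst. Qed.

Lemma up0_nvar : up0 nvar = nvar.
Proof. extensionality i. now destruct i. Qed.

Lemma up1_fvar : up1 fvar = fvar.
Proof. extensionality i. now destruct i. Qed.

Lemma up0_comp n2 s2 (n1 : nat -> num) :
  (fun i => num_subst (up0 n2) s2 (up0 n1 i)) =
  up0 (fun i => num_subst n2 s2 (n1 i)).
Proof.
  extensionality i. destruct i; simpl; trivial. apply up0_shift.
Qed.

Lemma up1_comp s2 (s1 : nat -> fn) :
  (fun i => fn_subst (up1 s2) (up1 s1 i)) = up1 (fun i => fn_subst s2 (s1 i)).
Proof.
  extensionality i. destruct i; simpl; trivial. apply up1_fshift.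
Qed.

Lemma nshift1_comp n2 s2 (n1 : nat -> num) :
  (fun i => num_subst (fun j => nshift1 (n2 j)) (up1 s2) (nshift1 (n1 i))) =
  (fun i => nshift1 (num_subst n2 s2 (n1 i))).
Proof. extensionality i. apply up1_shift. Qed.

Lemma form_subst_id A : form_subst nvar fvar A = A.
Proof.
  induction A; simpl; rewrite ?num_subst_id, ?fn_subst_id, ?up0_nvar, ?up1_fvar;
    try change (fun i => nshift1 (nvar i)) with nvar; congruence.
Qed.

Lemma form_subst_subst n2 s2 n1 s1 A :
  form_subst n2 s2 (form_subst n1 s1 A) =
  form_subst (fun i => num_subst n2 s2 (n1 i)) (fun i => fn_subst s2 (s1 i)) A.
Proof.
  revert n2 s2 n1 s1.
  induction A; intros; simpl; rewrite ?num_subst_subst, ?fn_subst_subst; f_equal;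
    rewrite ?IHA, ?up0_comp, ?up1_comp, ?nshift1_comp; trivial.
Qed.

(** * Free variables: every formula depends on finitely many indices *)

(** A semantic way to say that all free indices, of both sorts, lie below [N]: the result of a
    substitution is determined by its values there. This yields fresh variables without a syntactic
    notion of free variable. *)
Definition depends_below {X Y} (N : nat) (F : (nat -> num) -> (nat -> fn) -> X -> Y)
  (x : X) : Prop :=
  forall n n' s s', (forall i, i < N -> n i = n' i /\ s i = s' i) ->
    F n s x = F n' s' x.

Lemma fn_depends f : exists N, depends_below N (fun _ => fn_subst) f.
Proof.
  destruct f as [i|c].
  - exists (S i). intros n n' s s' H. apply H. lia.
  - exists 0. intros n n' s s' H. reflexivity.
Qed.

Lemma depends_mono {X Y} N M (F : (nat -> num) -> (nat -> fn) -> X -> Y) x :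
  N <= M -> depends_below N F x -> depends_below M F x.
Proof. intros L H n n' s s' E. apply H. intros i Hi. apply E. lia. Qed.

Lemma num_depends t : exists N, depends_below N num_subst t.
Proof.
  induction t as [i| |t [N HN] u [M HM]|f t [N HN]].
  - exists (S i). intros n n' s s' H. apply H. lia.
  - exists 0. intros n n' s s' H. reflexivity.
  - exists (max N M). intros n n' s s' E. simpl.
    f_equal; [apply HN|apply HM]; intros; apply E; lia.
  - destruct (fn_depends f) as [M HM].
    exists (max N M). intros n n' s s' E. simpl.
    f_equal; [apply (HM n n')|apply HN]; intros; apply E; lia.
Qed.

Lemma form_depends A : exists N, depends_below N form_subst A.
Proof.
  induction A as [t u|f g| |A [N HN] B [M HM]|A [N HN] B [M HM]|A [N HN] B [M HM]
    |A [N HN]|A [N HN]|A [N HN]|A [N HN]].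
  - destruct (num_depends t) as [N HN], (num_depends u) as [M HM].
    exists (max N M). intros n n' s s' E. simpl.
    f_equal; [apply HN|apply HM]; intros; apply E; lia.
  - destruct (fn_depends f) as [N HN], (fn_depends g) as [M HM].
    exists (max N M). intros n n' s s' E. simpl.
    f_equal; [apply (HN n n')|apply (HM n n')]; intros; apply E; lia.
  - exists 0. intros n n' s s' H. reflexivity.
  - exists (max N M). intros n n' s s' E. simpl.
    f_equal; [apply HN|apply HM]; intros; apply E; lia.
  - exists (max N M). intros n n' s s' E. simpl.
    f_equal; [apply HN|apply HM]; intros; apply E; lia.
  - exists (max N M). intros n n' s s' E. simpl.
    f_equal; [apply HN|apply HM]; intros; apply E; lia.
  (* Both sorts share the bound and a quantifier lowers the indices of one sort only, so the bound
     of the body is kept. *)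
  - exists N. intros n n' s s' E. simpl. f_equal. apply HN.
    intros [|i] Hi; simpl; split; trivial; try (f_equal; apply E; lia); apply E; lia.
  - exists N. intros n n' s s' E. simpl. f_equal. apply HN.
    intros [|i] Hi; simpl; split; trivial; try (f_equal; apply E; lia); apply E; lia.
  - exists N. intros n n' s s' E. simpl. f_equal. apply HN.
    intros [|i] Hi; simpl; split; trivial; f_equal; apply E; lia.
  - exists N. intros n n' s s' E. simpl. f_equal. apply HN.
    intros [|i] Hi; simpl; split; trivial; f_equal; apply E; lia.
Qed.

Lemma context_depends G :
  exists N, forall A, In A G -> depends_below N form_subst A.
Proof.
  induction G as [|A G [N HN]].
  - exists 0. intros A [].
  - destruct (form_depends A) as [M HM]. exists (max N M).
    intros B [<-|HB].
    + revert HM. apply depends_mono. lia.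
    + generalize (HN B HB). apply depends_mono. lia.
Qed.

(** * Stability of derivations under substitution and weakening *)

Lemma inst0_subst n s A t :
  form_subst n s (inst0 A t) =
  inst0 (form_subst (up0 n) s A) (num_subst n s t).
Proof.
  unfold inst0. rewrite !form_subst_subst. f_equal; extensionality i.
  - destruct i; simpl; trivial. unfold nshift0. rewrite num_subst_subst.
    symmetry. apply num_subst_id.
  - symmetry. apply fn_subst_id.
Qed.

Lemma inst1_subst n s A f :
  form_subst n s (inst1 A f) =
  inst1 (form_subst (fun i => nshift1 (n i)) (up1 s) A) (fn_subst s f).
Proof.
  unfold inst1. rewrite !form_subst_subst. f_equal; extensionality i.
  - unfold nshift1. rewrite num_subst_subst. symmetry. simpl. apply num_subst_id.
  - destruct i; simpl; trivial. unfold fshift1. rewrite fn_subst_subst.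
    symmetry. apply fn_subst_id.
Qed.

Lemma shift0_subst n s A :
  form_subst (up0 n) s (shift0 A) = shift0 (form_subst n s A).
Proof.
  unfold shift0. rewrite !form_subst_subst. f_equal.
  extensionality i. symmetry. apply fn_subst_id.
Qed.

Lemma shift1_subst n s A :
  form_subst (fun i => nshift1 (n i)) (up1 s) (shift1 A) =
  shift1 (form_subst n s A).
Proof. unfold shift1. now rewrite !form_subst_subst. Qed.

Lemma at_succ_subst n s A :
  form_subst (up0 n) s (at_succ A) = at_succ (form_subst (up0 n) s A).
Proof.
  unfold at_succ. rewrite !form_subst_subst. f_equal; extensionality i.
  - destruct i; simpl; trivial. unfold nshift0. now rewrite num_subst_subst.
  - symmetry. apply fn_subst_id.
Qed.

Lemma axiom_subst n s A : axiom A -> axiom (form_subst n s A).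
Proof.
  destruct 1;
    (* The closed axioms are convertible with their substitution instances. What remains are
       reflexivity, the Leibniz schemes and induction, whose instances commute with substitution. *)
    try solve [match goal with |- axiom ?B =>
      match B with form_subst _ _ ?A => change (axiom A) end end; constructor];
    simpl; rewrite ?inst0_subst, ?inst1_subst, ?at_succ_subst; constructor.
Qed.

Lemma map_shift0_subst n s G :
  map (form_subst (up0 n) s) (map shift0 G) = map shift0 (map (form_subst n s) G).
Proof. rewrite !map_map. apply map_ext. intro. apply shift0_subst. Qed.

Lemma map_shift1_subst n s G :
  map (form_subst (fun i => nshift1 (n i)) (up1 s)) (map shift1 G) =
  map shift1 (map (form_subst n s) G).
Proof. rewrite !map_map. apply map_ext. intro. apply shift1_subst. Qed.

(** Its purpose is to rename a fresh variable into the bound one that the quantifier rules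
    expect. *)
Lemma derives_subst G A : derives G A ->
  forall n s, derives (map (form_subst n s) G) (form_subst n s A).
Proof.
  induction 1; intros n s; simpl in *.
  - apply d_ax, axiom_subst; trivial.
  - apply d_hyp, in_map; trivial.
  - apply d_botE; apply IHderives.
  - apply d_andI; trivial.
  - eapply d_andE1; apply IHderives.
  - eapply d_andE2; apply IHderives.
  - apply d_orI1; trivial.
  - apply d_orI2; trivial.
  - eapply d_orE; [apply IHderives1|apply IHderives2|apply IHderives3].
  - apply d_impI; apply IHderives.
  - eapply d_impE; [apply IHderives1|apply IHderives2].
  - apply d_all0I. rewrite <- map_shift0_subst. apply IHderives.
  - rewrite inst0_subst. apply d_all0E. apply IHderives.
  - apply d_ex0I with (num_subst n s t). rewrite <- inst0_subst. apply IHderives.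
  - eapply d_ex0E; [apply IHderives1|].
    rewrite <- map_shift0_subst, <- shift0_subst. apply IHderives2.
  - apply d_all1I. rewrite <- map_shift1_subst. apply IHderives.
  - rewrite inst1_subst. apply d_all1E. apply IHderives.
  - apply d_ex1I with (fn_subst s f). rewrite <- inst1_subst. apply IHderives.
  - eapply d_ex1E; [apply IHderives1|].
    rewrite <- map_shift1_subst, <- shift1_subst. apply IHderives2.
Qed.

Lemma derives_weaken G D A : derives G A -> incl G D -> derives D A.
Proof.
  intros H. revert D. induction H; intros D I.
  - now apply d_ax.
  - now apply d_hyp, I.
  - apply d_botE; auto.
  - apply d_andI; auto.
  - eapply d_andE1; auto.
  - eapply d_andE2; auto.
  - apply d_orI1; auto.
  - apply d_orI2; auto.
  - eapply d_orE; [auto| |];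
      [apply IHderives2|apply IHderives3]; apply incl_cons; simpl; auto using incl_tl.
  - apply d_impI, IHderives. apply incl_cons; simpl; auto using incl_tl.
  - eapply d_impE; auto.
  - apply d_all0I, IHderives. now apply incl_map.
  - apply d_all0E; auto.
  - eapply d_ex0I; auto.
  - eapply d_ex0E; [auto|]. apply IHderives2.
    apply incl_cons; simpl; auto using incl_tl, incl_map.
  - apply d_all1I, IHderives. now apply incl_map.
  - apply d_all1E; auto.
  - eapply d_ex1I; auto.
  - eapply d_ex1E; [auto|]. apply IHderives2.
    apply incl_cons; simpl; auto using incl_tl, incl_map.
Qed.

(** * Rules without shifts *)

(* Instantiating a rule at the variable [N], with [N] fresh, and then renaming [N] to 0
   and each other [i] to [S i] yields the shifted premise of the official rule. *)
Definition rename0 (N i : nat) : num := if i =? N then nvar 0 else nvar (S i).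
Definition rename1 (N i : nat) : fn := if i =? N then fvar 0 else fvar (S i).

Lemma rename0_inst N A :
  depends_below N form_subst A ->
  form_subst (rename0 N) fvar (inst0 A (nvar N)) = A.
Proof.
  intros H. unfold inst0. rewrite form_subst_subst.
  transitivity (form_subst nvar fvar A); [|apply form_subst_id].
  apply H. intros [|i] Hi; simpl; unfold rename0.
  - now rewrite Nat.eqb_refl.
  - destruct (Nat.eqb_spec i N); [lia|]. split; trivial.
Qed.

Lemma rename0_shift N A :
  depends_below N form_subst A -> form_subst (rename0 N) fvar A = shift0 A.
Proof.
  intros H. apply H. intros i Hi. unfold rename0.
  destruct (Nat.eqb_spec i N); [lia|]. split; trivial.
Qed.

Lemma rename1_inst N A :
  depends_below N form_subst A ->
  form_subst nvar (rename1 N) (inst1 A (fvar N)) = A.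
Proof.
  intros H. unfold inst1. rewrite form_subst_subst.
  transitivity (form_subst nvar fvar A); [|apply form_subst_id].
  apply H. intros [|i] Hi; simpl; unfold rename1.
  - now rewrite Nat.eqb_refl.
  - destruct (Nat.eqb_spec i N); [lia|]. split; trivial.
Qed.

Lemma rename1_shift N A :
  depends_below N form_subst A -> form_subst nvar (rename1 N) A = shift1 A.
Proof.
  intros H. apply H. intros i Hi. unfold rename1.
  destruct (Nat.eqb_spec i N); [lia|]. split; trivial.
Qed.

Lemma map_ext_depends N G (f g : form -> form) :
  (forall A, In A G -> depends_below N form_subst A) ->
  (forall A, depends_below N form_subst A -> f A = g A) ->
  map f G = map g G.
Proof. intros H E. apply map_ext_in. auto. Qed.

(** The premise for all terms is used at a single fresh variable only. In return the context need
    not be shifted. *)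
Lemma all0_intro G A : (forall t, derives G (inst0 A t)) -> derives G (fAll0 A).
Proof.
  intros H. apply d_all0I.
  destruct (context_depends (A :: G)) as [N HN].
  generalize (derives_subst _ _ (H (nvar N)) (rename0 N) fvar).
  rewrite rename0_inst by (apply HN; simpl; auto).
  rewrite (map_ext_depends N G _ shift0); trivial.
  - intros B HB. apply HN; simpl; auto.
  - apply rename0_shift.
Qed.

Lemma all1_intro G A : (forall f, derives G (inst1 A f)) -> derives G (fAll1 A).
Proof.
  intros H. apply d_all1I.
  destruct (context_depends (A :: G)) as [N HN].
  generalize (derives_subst _ _ (H (fvar N)) nvar (rename1 N)).
  rewrite rename1_inst by (apply HN; simpl; auto).
  rewrite (map_ext_depends N G _ shift1); trivial.
  - intros B HB. apply HN; simpl; auto.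
  - apply rename1_shift.
Qed.

Lemma imp_intro G A B :
  (forall D, incl G D -> derives D A -> derives D B) -> derives G (A ==> B).
Proof.
  intros H. apply d_impI, H; [apply incl_tl, incl_refl|apply d_hyp; simpl; auto].
Qed.

Lemma or_elim G A B C : derives G (A \/ B) ->
  (forall D, incl G D -> derives D A -> derives D C) ->
  (forall D, incl G D -> derives D B -> derives D C) -> derives G C.
Proof.
  intros H HA HB. eapply d_orE; [exact H| |];
    [apply HA|apply HB]; solve [apply incl_tl, incl_refl|apply d_hyp; simpl; auto].
Qed.

Lemma ex0_elim G A C : derives G (fEx0 A) ->
  (forall D t, incl G D -> derives D (inst0 A t) -> derives D C) -> derives G C.
Proof.
  intros H HC. eapply d_ex0E; [exact H|].
  destruct (context_depends (A :: C :: G)) as [N HN].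
  assert (K : derives (inst0 A (nvar N) :: G) C).
  { apply HC with (nvar N); [apply incl_tl, incl_refl|apply d_hyp; simpl; auto]. }
  apply derives_subst with (n := rename0 N) (s := fvar) in K. simpl in K.
  rewrite rename0_inst in K by (apply HN; simpl; auto).
  rewrite rename0_shift in K by (apply HN; simpl; auto).
  rewrite (map_ext_depends N G _ shift0) in K; trivial.
  - intros B HB. apply HN; simpl; auto.
  - apply rename0_shift.
Qed.

Lemma ex1_elim G A C : derives G (fEx1 A) ->
  (forall D f, incl G D -> derives D (inst1 A f) -> derives D C) -> derives G C.
Proof.
  intros H HC. eapply d_ex1E; [exact H|].
  destruct (context_depends (A :: C :: G)) as [N HN].
  assert (K : derives (inst1 A (fvar N) :: G) C).
  { apply HC with (fvar N); [apply incl_tl, incl_refl|apply d_hyp; simpl; auto]. }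
  apply derives_subst with (n := nvar) (s := rename1 N) in K. simpl in K.
  rewrite rename1_inst in K by (apply HN; simpl; auto).
  rewrite rename1_shift in K by (apply HN; simpl; auto).
  rewrite (map_ext_depends N G _ shift1) in K; trivial.
  - intros B HB. apply HN; simpl; auto.
  - apply rename1_shift.
Qed.

Lemma inst0_at_succ A t : inst0 (at_succ A) t = inst0 A (cSucc t).
Proof.
  unfold inst0, at_succ. rewrite form_subst_subst. f_equal.
  extensionality i. now destruct i.
Qed.

(** The step is demanded in every larger context, because the induction hypothesis enters as a new
    assumption. *)
Lemma num_ind_rule G A : derives G (inst0 A nO) ->
  (forall D t, incl G D -> derives D (inst0 A t) -> derives D (inst0 A (cSucc t))) ->
  forall t, derives G (inst0 A t).
Proof.
  intros H0 HS t. apply d_all0E.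
  eapply d_impE; [eapply d_impE; [apply d_ax, ax_ind|exact H0]|].
  apply all0_intro. intros u.
  change (derives G (inst0 A u ==> inst0 (at_succ A) u)).
  apply imp_intro. intros D I Hu. rewrite inst0_at_succ. auto.
Qed.

(** * Instances of formulas *)

Lemma inst_nshift0 t u :
  num_subst (fun i => match i with O => t | S j => nvar j end) fvar (nshift0 u) = u.
Proof.
  unfold nshift0. rewrite num_subst_subst. apply num_subst_id.
Qed.

Lemma inst_nshift1 f u :
  num_subst nvar (fun i => match i with O => f | S j => fvar j end) (nshift1 u) = u.
Proof.
  unfold nshift1. rewrite num_subst_subst. apply num_subst_id.
Qed.

Lemma inst_fshift1 f g :
  fn_subst (fun i => match i with O => f | S j => fvar j end) (fshift1 g) = g.
Proof.
  unfold fshift1. rewrite fn_subst_subst. apply fn_subst_id.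
Qed.

Lemma subst_nvar_nshift0 s t :
  num_subst nvar s (nshift0 t) = nshift0 (num_subst nvar s t).
Proof. rewrite <- up0_nvar at 1. apply up0_shift. Qed.

Lemma subst_nadd n s t u :
  num_subst n s (nadd t u) = nadd (num_subst n s t) (num_subst n s u).
Proof. reflexivity. Qed.

Lemma subst_nmul n s t u :
  num_subst n s (nmul t u) = nmul (num_subst n s t) (num_subst n s u).
Proof. reflexivity. Qed.

Lemma subst_lo n s t : num_subst n s (lo t) = lo (num_subst n s t).
Proof. reflexivity. Qed.

Lemma subst_hi n s t : num_subst n s (hi t) = hi (num_subst n s t).
Proof. reflexivity. Qed.

Lemma subst_qsub n s t u :
  num_subst n s (qsub t u) = qsub (num_subst n s t) (num_subst n s u).
Proof. reflexivity. Qed.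

Lemma subst_qpow2inv n s t :
  num_subst n s (qpow2inv t) = qpow2inv (num_subst n s t).
Proof. reflexivity. Qed.

Lemma subst_entry n s t u :
  num_subst n s (entry t u) = entry (num_subst n s t) (num_subst n s u).
Proof. reflexivity. Qed.

Lemma subst_seq_length n s t :
  num_subst n s (seq_length t) = seq_length (num_subst n s t).
Proof. reflexivity. Qed.

(** The quantifier inside [fLt] keeps this from being a mere computation: the substitution has to
    pass the shift of the parameters. Rewriting with such equations leaves the defined notions
    folded. *)
Lemma subst_fLt n s t u :
  form_subst n s (fLt t u) = fLt (num_subst n s t) (num_subst n s u).
Proof.
  unfold fLt. cbn [form_subst]. rewrite subst_nadd, !up0_shift. reflexivity.
Qed.

Lemma subst_qlt n s t u :
  form_subst n s (qlt t u) = qlt (num_subst n s t) (num_subst n s u).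
Proof. unfold qlt. now rewrite subst_fLt. Qed.

Lemma subst_is_segment n s t :
  form_subst n s (is_segment t) = is_segment (num_subst n s t).
Proof. unfold is_segment. now rewrite subst_qlt. Qed.

Lemma subst_strictly_inside n s t u :
  form_subst n s (strictly_inside t u) =
  strictly_inside (num_subst n s t) (num_subst n s u).
Proof. unfold strictly_inside. cbn [form_subst]. now rewrite !subst_qlt. Qed.

Lemma subst_is_real n s x :
  form_subst n s (is_real x) = is_real (fn_subst s x).
Proof.
  unfold is_real. cbn [form_subst].
  now rewrite subst_is_segment, subst_strictly_inside, subst_qlt.
Qed.

Lemma subst_rlt n s x y :
  form_subst n s (rlt x y) = rlt (fn_subst s x) (fn_subst s y).
Proof. unfold rlt. cbn [form_subst]. now rewrite subst_qlt. Qed.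

Lemma subst_rle n s x y :
  form_subst n s (rle x y) = rle (fn_subst s x) (fn_subst s y).
Proof. unfold rle. cbn [form_subst]. now rewrite subst_rlt. Qed.

Lemma subst_in_unit n s x :
  form_subst n s (in_unit x) = in_unit (fn_subst s x).
Proof. unfold in_unit. cbn [form_subst]. now rewrite subst_is_real, !subst_rle. Qed.

Lemma subst_in_H n s a x :
  form_subst n s (in_H a x) = in_H (fn_subst s a) (fn_subst s x).
Proof.
  unfold in_H. cbn [form_subst].
  now rewrite subst_is_real, subst_is_segment, subst_strictly_inside.
Qed.

#[local] Hint Rewrite inst_nshift0 inst_nshift1 inst_fshift1 subst_nvar_nshift0
  subst_nadd subst_nmul subst_lo subst_hi subst_qsub subst_qpow2inv
  subst_fLt subst_qlt subst_is_segment subst_strictly_inside subst_is_real subst_rlt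
  subst_rle subst_in_unit subst_in_H up0_shift up1_shift up1_fshift up0_nvar
  up1_fvar fn_subst_id num_subst_id : subst.

Ltac ssimpl :=
  unfold inst0, inst1;
  repeat progress (cbn [form_subst num_subst fn_subst up0 up1];
                   autorewrite with subst).
Ltac ssimpl_in H :=
  unfold inst0, inst1 in H;
  repeat progress (cbn [form_subst num_subst fn_subst up0 up1] in H;
                   autorewrite with subst in H).

(** * Reasoning in a growing context *)

Definition eqn (G : list form) (t u : num) : Prop := derives G (t == u).

(* moves all hypotheses along an inclusion [I] of contexts *)
Ltac enter I :=
  match type of I with incl ?G ?D =>
    repeat match goal with
    | H : derives G _ |- _ => apply (fun K => derives_weaken _ _ _ K I) in H
    | H : eqn G _ _ |- _ => apply (fun K : derives _ _ => derives_weaken _ _ _ K I) in H;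
        match type of H with derives D (?t == ?u)%bim => change (eqn D t u) in H end
    end; clear I; try clear G
  end.

Ltac fold_eqn :=
  repeat match goal with
  | H : derives ?G (fEq0 ?t ?u) |- _ => change (eqn G t u) in H
  | |- derives ?G (fEq0 ?t ?u) => change (eqn G t u)
  end.

Tactic Notation "assume" ident(H) :=
  apply imp_intro; let D := fresh "D" in let I := fresh "I" in
  intros D I H; enter I; fold_eqn.
Tactic Notation "cases" open_constr(K) "as" ident(H) :=
  eapply or_elim; [exact K| |];
  let D := fresh "D" in let I := fresh "I" in intros D I H; enter I; fold_eqn.
Tactic Notation "obtain0" ident(t) ident(H) "from" open_constr(K) :=
  eapply ex0_elim; [exact K|];
  let D := fresh "D" in let I := fresh "I" in intros D t I H; enter I;
  ssimpl_in H; fold_eqn.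
Tactic Notation "obtain1" ident(f) ident(H) "from" open_constr(K) :=
  eapply ex1_elim; [exact K|];
  let D := fresh "D" in let I := fresh "I" in intros D f I H; enter I;
  ssimpl_in H; fold_eqn.
Tactic Notation "give0" constr(t) := apply d_ex0I with t; ssimpl.
Tactic Notation "give1" constr(f) := apply d_ex1I with f; ssimpl.
(* Induction inside BIM: [A] has [nvar 0] as its induction variable and its parameters lifted by
   shifts, which cancel when [A] is instantiated. *)
Tactic Notation "induct" constr(A) "at" constr(t) "as" ident(n) ident(IH) :=
  let K := fresh "K" in
  try match goal with |- eqn ?G ?t ?u => change (derives G (t == u)) end;
  match goal with |- derives ?G _ =>
    assert (K : derives G (inst0 A t));
    [apply num_ind_rule;
     [ssimpl
     |let D := fresh "D" in let I := fresh "I" in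
      intros D n I IH; enter I; ssimpl_in IH; ssimpl]; fold_eqn
    |ssimpl_in K; exact K]
  end.

(** * Equality *)

(** Provable equality in a fixed context becomes a setoid, so that rewriting acts inside the
    calculus. Symmetry and transitivity are Leibniz's law for well-chosen equations. *)
#[local] Instance eqn_equivalence G : Equivalence (eqn G).
Proof.
  assert (S : forall t u, eqn G t u -> eqn G u t).
  { intros t u H.
    pose proof (d_ax G _ (ax_leibniz0 (nvar 0 == nshift0 t)%bim t u)) as K.
    ssimpl_in K. eapply d_impE; [eapply d_impE; [exact K|exact H]|].
    apply d_ax, ax_refl0. }
  split.
  - intro t. apply d_ax, ax_refl0.
  - exact S.
  - intros t u v H1 H2.
    pose proof (d_ax G _ (ax_leibniz0 (nshift0 t == nvar 0)%bim u v)) as K.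
    ssimpl_in K. eapply d_impE; [eapply d_impE; [exact K|exact H2]|exact H1].
Qed.

#[local] Instance napp_proper G (f : fn) :
  Morphisms.Proper (Morphisms.respectful (eqn G) (eqn G)) (napp f).
Proof.
  intros t u H.
  pose proof (d_ax G _ (ax_leibniz0 (f (nshift0 t) == f (nvar 0))%bim t u)) as K.
  ssimpl_in K. eapply d_impE; [eapply d_impE; [exact K|exact H]|].
  apply d_ax, ax_refl0.
Qed.

#[local] Instance nJ_proper G :
  Morphisms.Proper (Morphisms.respectful (eqn G) (Morphisms.respectful (eqn G) (eqn G))) nJ.
Proof.
  intros t u H t' u' H'. transitivity (nJ u t').
  - pose proof (d_ax G _ (ax_leibniz0
      (nJ (nshift0 t) (nshift0 t') == nJ (nvar 0) (nshift0 t'))%bim t u)) as K.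
    ssimpl_in K. eapply d_impE; [eapply d_impE; [exact K|exact H]|].
    apply d_ax, ax_refl0.
  - pose proof (d_ax G _ (ax_leibniz0
      (nJ (nshift0 u) (nshift0 t') == nJ (nshift0 u) (nvar 0))%bim t' u')) as K.
    ssimpl_in K. eapply d_impE; [eapply d_impE; [exact K|exact H']|].
    apply d_ax, ax_refl0.
Qed.

#[local] Instance nadd_proper G :
  Morphisms.Proper (Morphisms.respectful (eqn G) (Morphisms.respectful (eqn G) (eqn G))) nadd.
Proof. intros t u H t' u' H'. unfold nadd. now rewrite H, H'. Qed.

#[local] Instance nmul_proper G :
  Morphisms.Proper (Morphisms.respectful (eqn G) (Morphisms.respectful (eqn G) (eqn G))) nmul.
Proof. intros t u H t' u' H'. unfold nmul. now rewrite H, H'. Qed.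

Lemma succ_neq0 G t A : eqn G (cSucc t) nO -> derives G A.
Proof.
  intros H. apply d_botE. eapply d_impE; [|exact H].
  pose proof (d_all0E G _ t (d_ax _ _ ax_succ_neq0)) as K. now ssimpl_in K.
Qed.

Lemma succ_inj G t u : eqn G (cSucc t) (cSucc u) -> eqn G t u.
Proof.
  intros H. unfold eqn.
  pose proof (d_all0E _ _ u (d_all0E G _ t (d_ax _ _ ax_succ_inj))) as K.
  ssimpl_in K. eapply d_impE; [exact K|exact H].
Qed.

Lemma K_J G t u : eqn G (cK (nJ t u)) t.
Proof. pose proof (d_all0E _ _ u (d_all0E G _ t (d_ax _ _ ax_KJ))) as K. now ssimpl_in K. Qed.

Lemma L_J G t u : eqn G (cL (nJ t u)) u.
Proof. pose proof (d_all0E _ _ u (d_all0E G _ t (d_ax _ _ ax_LJ))) as K. now ssimpl_in K. Qed.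

Lemma J_K_L G t : eqn G (nJ (cK t) (cL t)) t.
Proof. pose proof (d_all0E G _ t (d_ax _ _ ax_JKL)) as K. now ssimpl_in K. Qed.

Lemma app_zero G t : eqn G (cZero t) nO.
Proof. pose proof (d_all0E G _ t (d_ax _ _ ax_zero)) as K. now ssimpl_in K. Qed.

Lemma app_id G t : eqn G (cId t) t.
Proof. pose proof (d_all0E G _ t (d_ax _ _ ax_id)) as K. now ssimpl_in K. Qed.

Lemma app_pair G (c d : con) t : eqn G (cPair c d t) (nJ (c t) (d t)).
Proof. pose proof (d_all0E G _ t (d_ax _ _ (ax_pair c d))) as K. now ssimpl_in K. Qed.

Lemma app_comp G (c d : con) t : eqn G (cComp c d t) (c (d t)).
Proof. pose proof (d_all0E G _ t (d_ax _ _ (ax_comp c d))) as K. now ssimpl_in K. Qed.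

Lemma rec_0 G (c d : con) t : eqn G (cRec c d (nJ t nO)) (c t).
Proof. pose proof (d_all0E G _ t (d_ax _ _ (ax_rec0 c d))) as K. now ssimpl_in K. Qed.

Lemma rec_S G (c d : con) t u :
  eqn G (cRec c d (nJ t (cSucc u))) (d (nJ (nJ t u) (cRec c d (nJ t u)))).
Proof.
  pose proof (d_all0E _ _ u (d_all0E G _ t (d_ax _ _ (ax_recS c d)))) as K.
  now ssimpl_in K.
Qed.

(** [ev] does not reduce projections of an opaque argument: pairs that a constant
    takes apart must be made explicit first, as in [rat_eta]. *)
Fixpoint ev (c : con) (t : num) : num :=
  match c with
  | cZero => nO
  | cId => t
  | cPair c d => nJ (ev c t) (ev d t)
  | cComp c d => ev c (ev d t)
  | cK => match t with nJ a _ => a | _ => cK t end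
  | cL => match t with nJ _ b => b | _ => cL t end
  | _ => c t
  end.

Lemma ev_correct G (c : con) t : eqn G (c t) (ev c t).
Proof.
  revert t. induction c; intros t; simpl; try reflexivity.
  - apply app_zero.
  - apply app_id.
  - destruct t; try reflexivity. apply K_J.
  - destruct t; try reflexivity. apply L_J.
  - rewrite app_pair. now rewrite IHc1, IHc2.
  - rewrite app_comp. now rewrite IHc2, IHc1.
Qed.

(** * The semiring of natural numbers *)

Lemma add_0_r G t : eqn G (nadd t nO) t.
Proof. unfold nadd, cAdd. rewrite rec_0. apply app_id. Qed.

Lemma add_S_r G t u : eqn G (nadd t (cSucc u)) (cSucc (nadd t u)).
Proof. unfold nadd, cAdd. rewrite rec_S. now rewrite app_comp, L_J. Qed.

Lemma mul_0_r G t : eqn G (nmul t nO) nO.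
Proof. unfold nmul, cMul. rewrite rec_0. apply app_zero. Qed.

Lemma mul_S_r G t u : eqn G (nmul t (cSucc u)) (nadd t (nmul t u)).
Proof.
  unfold nmul at 1, cMul. rewrite rec_S, ev_correct. reflexivity.
Qed.

Lemma add_0_l G t : eqn G (nadd nO t) t.
Proof.
  induct (nadd nO (nvar 0) == nvar 0)%bim at t as m IH.
  - apply add_0_r.
  - now rewrite add_S_r, IH.
Qed.

Lemma add_S_l G t u : eqn G (nadd (cSucc t) u) (cSucc (nadd t u)).
Proof.
  induct (nadd (cSucc (nshift0 t)) (nvar 0) == cSucc (nadd (nshift0 t) (nvar 0)))%bim
    at u as m IH.
  - now rewrite !add_0_r.
  - now rewrite !add_S_r, IH.
Qed.

Lemma add_comm G t u : eqn G (nadd t u) (nadd u t).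
Proof.
  induct (nadd (nshift0 t) (nvar 0) == nadd (nvar 0) (nshift0 t))%bim at u as m IH.
  - now rewrite add_0_r, add_0_l.
  - now rewrite add_S_r, add_S_l, IH.
Qed.

Lemma add_assoc G t u v : eqn G (nadd t (nadd u v)) (nadd (nadd t u) v).
Proof.
  induct (nadd (nshift0 t) (nadd (nshift0 u) (nvar 0)) ==
          nadd (nadd (nshift0 t) (nshift0 u)) (nvar 0))%bim at v as m IH.
  - now rewrite !add_0_r.
  - now rewrite !add_S_r, IH.
Qed.

Lemma mul_0_l G t : eqn G (nmul nO t) nO.
Proof.
  induct (nmul nO (nvar 0) == nO)%bim at t as m IH.
  - apply mul_0_r.
  - now rewrite mul_S_r, IH, add_0_r.
Qed.

Lemma mul_S_l G t u : eqn G (nmul (cSucc t) u) (nadd u (nmul t u)).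
Proof.
  induct (nmul (cSucc (nshift0 t)) (nvar 0) ==
          nadd (nvar 0) (nmul (nshift0 t) (nvar 0)))%bim at u as m IH.
  - now rewrite !mul_0_r, add_0_r.
  - now rewrite !mul_S_r, IH, !add_S_l, !add_assoc, (add_comm _ t m).
Qed.

Lemma mul_comm G t u : eqn G (nmul t u) (nmul u t).
Proof.
  induct (nmul (nshift0 t) (nvar 0) == nmul (nvar 0) (nshift0 t))%bim at u as m IH.
  - now rewrite mul_0_r, mul_0_l.
  - now rewrite mul_S_r, mul_S_l, IH.
Qed.

Lemma mul_add_r G t u v : eqn G (nmul t (nadd u v)) (nadd (nmul t u) (nmul t v)).
Proof.
  induct (nmul (nshift0 t) (nadd (nshift0 u) (nvar 0)) ==
          nadd (nmul (nshift0 t) (nshift0 u)) (nmul (nshift0 t) (nvar 0)))%bim at v as m IH.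
  - now rewrite mul_0_r, !add_0_r.
  - rewrite add_S_r, !mul_S_r, IH, !add_assoc.
    now rewrite (add_comm _ t (nmul t u)).
Qed.

Lemma mul_assoc G t u v : eqn G (nmul t (nmul u v)) (nmul (nmul t u) v).
Proof.
  induct (nmul (nshift0 t) (nmul (nshift0 u) (nvar 0)) ==
          nmul (nmul (nshift0 t) (nshift0 u)) (nvar 0))%bim at v as m IH.
  - now rewrite !mul_0_r.
  - now rewrite !mul_S_r, mul_add_r, IH.
Qed.

(** The empty context suffices, since a semiring identity provable there holds in every context by
    weakening. *)
Lemma num_semi_ring : semi_ring_theory nO num1 nadd nmul (eqn []).
Proof.
  split; intros.
  - apply add_0_l.
  - apply add_comm.
  - apply add_assoc.
  - unfold num1. now rewrite mul_S_l, mul_0_l, add_0_r.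
  - apply mul_0_l.
  - apply mul_comm.
  - apply mul_assoc.
  - now rewrite mul_comm, mul_add_r, (mul_comm _ p n), (mul_comm _ p m).
Qed.

Lemma num_sring_ext : sring_eq_ext nadd nmul (eqn []).
Proof. split; intros t u H t' u' H'; now rewrite H, H'. Qed.

Add Ring num_ring : num_semi_ring
  (setoid (eqn_equivalence []) num_sring_ext).

Lemma eqn_weaken G t u : eqn [] t u -> eqn G t u.
Proof. intros H. exact (derives_weaken _ _ _ H (incl_nil_l G)). Qed.

Lemma succ_add G t : eqn G (cSucc t) (nadd t num1).
Proof. unfold num1. now rewrite add_S_r, add_0_r. Qed.

(** * Order *)

Definition fLe (t u : num) : form := fEx0 (nadd (nshift0 t) (nvar 0) == nshift0 u).

Lemma subst_fLe n s t u :
  form_subst n s (fLe t u) = fLe (num_subst n s t) (num_subst n s u).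
Proof.
  unfold fLe. cbn [form_subst]. rewrite subst_nadd, !up0_shift. reflexivity.
Qed.
#[local] Hint Rewrite subst_fLe : subst.

Lemma zero_or_succ G t :
  derives G (t == nO \/ fEx0 (nshift0 t == cSucc (nvar 0))).
Proof.
  induct (nvar 0 == nO \/ fEx0 (nshift0 (nvar 0) == cSucc (nvar 0)))%bim at t as m IH.
  - apply d_orI1. apply d_ax, ax_refl0.
  - apply d_orI2. give0 m. apply d_ax, ax_refl0.
Qed.

Lemma add_cancel_l G t u v : eqn G (nadd t u) (nadd t v) -> eqn G u v.
Proof.
  assert (H : derives G (nadd t u == nadd t v ==> u == v)).
  { induct (nadd (nvar 0) (nshift0 u) == nadd (nvar 0) (nshift0 v) ==>
            nshift0 u == nshift0 v)%bim at t as m IH.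
    - assume H. now rewrite !add_0_l in H.
    - assume H. rewrite !add_S_l in H. apply succ_inj in H.
      exact (d_impE _ _ _ IH H). }
  intros E. exact (d_impE _ _ _ H E).
Qed.

Lemma add_succ_neq G t d A : eqn G (nadd t (nadd d num1)) t -> derives G A.
Proof.
  intros H. apply succ_neq0 with d. apply add_cancel_l with t.
  now rewrite succ_add, H, add_0_r.
Qed.

Lemma lt_intro G t u d : eqn G (nadd t (nadd d num1)) u -> derives G (fLt t u).
Proof. intros H. give0 d. fold_eqn. now rewrite succ_add. Qed.

Lemma lt_elim G t u C : derives G (fLt t u) ->
  (forall D d, incl G D -> eqn D (nadd t (nadd d num1)) u -> derives D C) ->
  derives G C.
Proof.
  intros H HC. eapply ex0_elim; [exact H|]. intros D d I E. apply (HC D d I).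
  ssimpl_in E. fold_eqn. now rewrite succ_add in E.
Qed.

Lemma le_intro G t u d : eqn G (nadd t d) u -> derives G (fLe t u).
Proof. intros H. give0 d. exact H. Qed.

Lemma le_elim G t u C : derives G (fLe t u) ->
  (forall D d, incl G D -> eqn D (nadd t d) u -> derives D C) -> derives G C.
Proof.
  intros H HC. eapply ex0_elim; [exact H|]. intros D d I E. apply (HC D d I).
  now ssimpl_in E.
Qed.

Tactic Notation "gap" ident(d) ident(H) "from" open_constr(K) :=
  first [eapply lt_elim; [exact K|]|eapply le_elim; [exact K|]];
  let D := fresh "D" in let I := fresh "I" in intros D d I H; enter I.

Ltac nring := apply eqn_weaken; ring.

Lemma lt_le G t u : derives G (fLt t u) -> derives G (fLe t u).
Proof. intros H. gap d E from H. now apply le_intro with (nadd d num1). Qed.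

Lemma lt_succ_le G t u : derives G (fLt t u) -> derives G (fLe (nadd t num1) u).
Proof. intros H. gap d E from H. apply le_intro with d. rewrite <- E. nring. Qed.

(** Decidability of the order, by induction on [u]. It supplies the case distinctions on rationals
    that intuitionistic logic does not give for free. *)
Lemma lt_or_le G t u : derives G (fLt t u \/ fLe u t).
Proof.
  induct (fLt (nshift0 t) (nvar 0) \/ fLe (nvar 0) (nshift0 t))%bim at u as m IH.
  - apply d_orI2, le_intro with t. apply add_0_l.
  - cases IH as H.
    + gap d E from H. apply d_orI1, lt_intro with (nadd d num1).
      rewrite succ_add, <- E. nring.
    + gap d E from H. cases (zero_or_succ _ d) as Hd.
      * apply d_orI1, lt_intro with nO. rewrite succ_add, <- E, Hd. nring.
      * obtain0 e He from Hd. apply d_orI2, le_intro with e.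
        rewrite <- E, He, !succ_add. nring.
Qed.

Lemma lt_eqn G t t' u u' :
  eqn G t t' -> eqn G u u' -> derives G (fLt t u) -> derives G (fLt t' u').
Proof.
  intros H H' K. gap d E from K. apply lt_intro with d. now rewrite <- H, E.
Qed.

Lemma le_add G t u t' u' : derives G (fLe t u) -> derives G (fLe t' u') ->
  derives G (fLe (nadd t t') (nadd u u')).
Proof.
  intros H H'. gap d E from H. gap d' E' from H'. apply le_intro with (nadd d d').
  rewrite <- E, <- E'. nring.
Qed.

Lemma le_mul G k t u : derives G (fLe t u) -> derives G (fLe (nmul k t) (nmul k u)).
Proof. intros H. gap d E from H. apply le_intro with (nmul k d). rewrite <- E. nring. Qed.

(** Every rational inequality below is such a combination, with products of
    denominators as coefficients. *)
Lemma lt_linear G k1 k2 k3 a1 b1 a2 b2 a3 b3 :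
  derives G (fLt a1 b1) -> derives G (fLe a2 b2) ->
  eqn G (nadd (nadd (nmul (nadd k1 num1) b1) (nmul k2 b2)) (nmul (nadd k3 num1) a3))
        (nadd (nadd (nmul (nadd k1 num1) a1) (nmul k2 a2)) (nmul (nadd k3 num1) b3)) ->
  derives G (fLt a3 b3).
Proof.
  intros H1 H2 E. cases (lt_or_le G a3 b3) as H3; trivial.
  gap d1 E1 from H1. gap d2 E2 from H2. gap d3 E3 from H3.
  (* If [b3 <= a3], the left side of [E] exceeds the right side by
     [(k1+1)(d1+1) + k2 d2 + (k3+1) d3]. The second term given here is this surplus less 1. *)
  apply add_succ_neq with
    (nadd (nadd (nmul (nadd k1 num1) a1) (nmul k2 a2)) (nmul (nadd k3 num1) b3))
    (nadd (nadd (nmul k1 d1) (nadd k1 d1))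
          (nadd (nmul k2 d2) (nmul (nadd k3 num1) d3))).
  etransitivity; [|exact E]. rewrite <- E1, <- E2, <- E3. nring.
Qed.

(** * Rationals *)

(** [qlt q r] is [fLt (cross q r) (cross r q)]. *)
Definition cross (q r : num) : num :=
  nadd (nmul (qpos q) (qden r)) (nmul (qneg r) (qden q)).

Definition qle (q r : num) : form := fLe (cross q r) (cross r q).

#[local] Instance qpos_proper G :
  Morphisms.Proper (Morphisms.respectful (eqn G) (eqn G)) qpos.
Proof. intros q r H. unfold qpos. now rewrite H. Qed.

#[local] Instance cross_proper G :
  Morphisms.Proper (Morphisms.respectful (eqn G) (Morphisms.respectful (eqn G) (eqn G)))
    cross.
Proof.
  intros q q' H r r' H'. unfold cross, qpos, qneg, qden. now rewrite H, H'.
Qed.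

Lemma cross_expand G q r :
  eqn G (cross q r)
    (nadd (nmul (qpos q) (nadd (cL r) num1)) (nmul (qneg r) (nadd (cL q) num1))).
Proof. unfold cross, qden. now rewrite !succ_add. Qed.

Lemma cross_J G a b c a' b' c' :
  eqn G (cross (nJ (nJ a b) c) (nJ (nJ a' b') c'))
    (nadd (nmul a (nadd c' num1)) (nmul b' (nadd c num1))).
Proof.
  rewrite cross_expand. unfold qpos, qneg. now rewrite !(K_J G (nJ _ _)), !L_J, !K_J.
Qed.

Lemma rat_eta G q : eqn G q (nJ (nJ (qpos q) (qneg q)) (cL q)).
Proof. unfold qpos, qneg. now rewrite !J_K_L. Qed.

Lemma qlt_cross G q r : derives G (fLt (cross q r) (cross r q)) -> derives G (qlt q r).
Proof. trivial. Qed.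

Lemma qlt_eqn G q q' r r' :
  eqn G q q' -> eqn G r r' -> derives G (qlt q r) -> derives G (qlt q' r').
Proof.
  intros H H'. apply lt_eqn; [change (eqn G (cross q r) (cross q' r'))
    |change (eqn G (cross r q) (cross r' q'))]; now rewrite H, H'.
Qed.

Lemma qle_qlt_trans G q r s :
  derives G (qle q r) -> derives G (qlt r s) -> derives G (qlt q s).
Proof.
  intros H H'. apply qlt_cross.
  apply (lt_linear G (cL q) (nadd (cL s) num1) (cL r) _ _ _ _ _ _ H' H).
  fold (cross r s) (cross s r). rewrite !cross_expand. nring.
Qed.

Lemma qlt_qle_trans G q r s :
  derives G (qlt q r) -> derives G (qle r s) -> derives G (qlt q s).
Proof.
  intros H H'. apply qlt_cross.
  apply (lt_linear G (cL s) (nadd (cL q) num1) (cL r) _ _ _ _ _ _ H H').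
  fold (cross q r) (cross r q). rewrite !cross_expand. nring.
Qed.

Lemma qlt_le G q r : derives G (qlt q r) -> derives G (qle q r).
Proof. apply lt_le. Qed.

Lemma qlt_trans G q r s :
  derives G (qlt q r) -> derives G (qlt r s) -> derives G (qlt q s).
Proof. intros H H'. exact (qlt_qle_trans _ _ _ _ H (qlt_le _ _ _ H')). Qed.

Lemma qlt_or_qle G q r : derives G (qlt q r \/ qle r q).
Proof. apply lt_or_le. Qed.

Lemma qlt_irrefl G q A : derives G (qlt q q) -> derives G A.
Proof. intros H. gap d E from H. exact (add_succ_neq _ _ _ _ E). Qed.

Lemma qlt_asym G q r A :
  derives G (qlt q r) -> derives G (qlt r q) -> derives G A.
Proof. intros H H'. apply qlt_irrefl with q. exact (qlt_trans _ _ _ _ H H'). Qed.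

(** * Powers of two and short intervals *)

Lemma pow2pred_0 G : eqn G (cPow2Pred nO) nO.
Proof.
  unfold cPow2Pred. rewrite app_comp, (ev_correct G (cPair _ _)); cbn [ev].
  rewrite rec_0. apply app_zero.
Qed.

Lemma pow2pred_S G n :
  eqn G (cPow2Pred (cSucc n)) (nadd (nadd (cPow2Pred n) (cPow2Pred n)) num1).
Proof.
  unfold cPow2Pred. rewrite !app_comp, !(ev_correct G (cPair cZero cId)); cbn [ev].
  rewrite rec_S, (ev_correct G (cComp cSucc _)); cbn [ev]. apply succ_add.
Qed.

Lemma le_pow2pred G n : derives G (fLe n (cPow2Pred n)).
Proof.
  induct (fLe (nvar 0) (cPow2Pred (nvar 0)))%bim at n as m IH.
  - apply le_intro with nO. now rewrite pow2pred_0, add_0_r.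
  - gap d E from IH. apply le_intro with (nadd d (cPow2Pred m)).
    rewrite pow2pred_S, succ_add, <- E. nring.
Qed.

(** If [q] and [r] have denominators [c] and [d], then [r - q >= 1/(cd) > 2^(-cd)]. *)
Lemma short_interval G q r s t :
  derives G (qlt q r) ->
  derives G (qlt (qsub t s) (qpow2inv (nmul (qden q) (qden r)))) ->
  derives G (qlt q s \/ qlt t r).
Proof.
  intros Hqr Hts. cases (qlt_or_qle G q s) as Hqs; [now apply d_orI1|].
  apply d_orI2, qlt_cross.
  set (m := nmul (qden q) (qden r)) in *.
  pose proof (le_pow2pred D m) as Hm. apply lt_succ_le in Hqr.
  assert (Em : eqn D m (nmul (nadd (cL q) num1) (nadd (cL r) num1))).
  { unfold m, qden. now rewrite !succ_add. }
  set (P := cPow2Pred m) in *.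
  set (E := nadd (cL s) num1). set (F := nadd (cL t) num1).
  set (P1 := nadd P num1).
  assert (Hm1 : derives D (fLe m P1)).
  { gap d Hd from Hm. apply le_intro with (nadd d num1).
    unfold P1. rewrite <- Hd. nring. }
  (* If [s <= q], then [t < r] follows from [t - s < 2^(-m)], [r - q >= 1/m] and [m <= 2^m]. The
     multipliers clear denominators: the first inequality is taken [m] times, and the conclusion is
     multiplied by the denominators of [q] and [s] and by [2^m]. *)
  eapply (lt_linear D (nadd (nadd (nmul (cL q) (cL r)) (cL q)) (cL r)) num1
     (nadd (nadd (nadd (nmul (cL q) (cL s)) (nadd (cL q) (cL s))) P)
           (nmul (nadd (nmul (cL q) (cL s)) (nadd (cL q) (cL s))) P))).
  - exact Hts.
  - apply le_add;
      [apply (le_mul _ (nmul (nmul E F) P1) _ _ Hqr)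
      |apply le_add;
       [apply (le_mul _ (nmul (nmul (nadd (cL r) num1) F) P1) _ _ Hqs)
       |apply (le_mul _ (nmul E F) _ _ Hm1)]].
  - fold (cross (qsub t s) (qpow2inv m)) (cross (qpow2inv m) (qsub t s))
      (cross q r) (cross r q).
    unfold qsub, qpow2inv. fold P. rewrite !cross_J, Em. unfold qden.
    rewrite !succ_add, !cross_expand. subst E F P1. nring.
Qed.

(** * Reals *)

Lemma real_segment G x n :
  derives G (is_real x) -> derives G (qlt (lo (x n)) (hi (x n))).
Proof.
  intros H. apply d_andE1 in H. apply (d_all0E _ _ n) in H. now ssimpl_in H.
Qed.

Lemma real_inside G x n :
  derives G (is_real x) -> derives G (strictly_inside (x (cSucc n)) (x n)).
Proof.
  intros H. apply d_andE2, d_andE1 in H. apply (d_all0E _ _ n) in H. now ssimpl_in H.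
Qed.

Lemma real_short G x m : derives G (is_real x) ->
  derives G (fEx0 (qlt (qsub (hi (x (nvar 0))) (lo (x (nvar 0))))
                       (qpow2inv (nshift0 m)))).
Proof.
  intros H. apply d_andE2, d_andE2 in H. apply (d_all0E _ _ m) in H. now ssimpl_in H.
Qed.

Lemma app_lo_eqn G (x : fn) t u : eqn G t u -> eqn G (lo (x t)) (lo (x u)).
Proof. intros H. unfold lo. now rewrite H. Qed.

Lemma app_hi_eqn G (x : fn) t u : eqn G t u -> eqn G (hi (x t)) (hi (x u)).
Proof. intros H. unfold hi. now rewrite H. Qed.

Lemma real_lo_mono G x q n k : derives G (is_real x) -> derives G (fLe n k) ->
  derives G (qlt q (lo (x n))) -> derives G (qlt q (lo (x k))).
Proof.
  intros Hx Hnk Hq. gap d E from Hnk.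
  apply (qlt_eqn _ q q (lo (x (nadd n d)))); [reflexivity|now apply app_lo_eqn|].
  induct (qlt (nshift0 q) (lo (x (nadd (nshift0 n) (nvar 0)))))%bim at d as m IH.
  - revert Hq. apply qlt_eqn; [reflexivity|]. apply app_lo_eqn. symmetry. apply add_0_r.
  - apply qlt_trans with (lo (x (nadd n m))); [exact IH|].
    pose proof (d_andE1 _ _ _ (real_inside _ x (nadd n m) Hx)) as J.
    revert J. apply qlt_eqn; [reflexivity|]. apply app_lo_eqn. symmetry. apply add_S_r.
Qed.

Lemma real_hi_mono G x q n k : derives G (is_real x) -> derives G (fLe n k) ->
  derives G (qlt (hi (x n)) q) -> derives G (qlt (hi (x k)) q).
Proof.
  intros Hx Hnk Hq. gap d E from Hnk.
  apply (qlt_eqn _ (hi (x (nadd n d))) _ q q); [now apply app_hi_eqn|reflexivity|].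
  induct (qlt (hi (x (nadd (nshift0 n) (nvar 0)))) (nshift0 q))%bim at d as m IH.
  - revert Hq. apply qlt_eqn; [|reflexivity]. apply app_hi_eqn. symmetry. apply add_0_r.
  - apply qlt_trans with (hi (x (nadd n m))); [|exact IH].
    pose proof (d_andE2 _ _ _ (d_andE2 _ _ _ (real_inside _ x (nadd n m) Hx))) as J.
    revert J. apply qlt_eqn; [|reflexivity]. apply app_hi_eqn. symmetry. apply add_S_r.
Qed.

Lemma le_add_r G t u : derives G (fLe t (nadd t u)).
Proof. now apply le_intro with u. Qed.

Lemma le_add_l G t u : derives G (fLe u (nadd t u)).
Proof. apply le_intro with t. apply add_comm. Qed.

(** The order of reals asks for one common index. As segments are nested, both can be moved to
    [n + k]. *)
Lemma rlt_intro G x y n k : derives G (is_real x) -> derives G (is_real y) ->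
  derives G (qlt (hi (x n)) (lo (y k))) -> derives G (rlt x y).
Proof.
  intros Hx Hy H. unfold rlt. give0 (nadd n k).
  eapply real_lo_mono; [exact Hy|apply le_add_l|].
  eapply real_hi_mono; [exact Hx|apply le_add_r|exact H].
Qed.

(** The constructive substitute for trichotomy: a segment of [x] shorter than [r - q] lies above [q]
    or below [r]. The product of the denominators is a sufficient precision. *)
Lemma real_compare G x q r : derives G (is_real x) -> derives G (qlt q r) ->
  derives G (fEx0 (qlt (nshift0 q) (lo (x (nvar 0))) \/
                   qlt (hi (x (nvar 0))) (nshift0 r))).
Proof.
  intros Hx Hqr. obtain0 n Hn from (real_short _ x (nmul (qden q) (qden r)) Hx).
  give0 n. now apply short_interval.
Qed.

(** * Rationals as reals *)

(** Equality of values, as a rational has several codes. *)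
Definition qeq (q r : num) : form := fEq0 (cross q r) (cross r q).

(* the codes of [p - 2^(-n)] and [p + 2^(-n)] *)
Definition qminus (p n : num) : num :=
  nJ (nJ (nmul (qpos p) (cSucc (cPow2Pred n)))
         (nadd (nmul (qneg p) (cSucc (cPow2Pred n))) (qden p)))
     (nadd (nmul (cL p) (cPow2Pred n)) (nadd (cL p) (cPow2Pred n))).
Definition qplus (p n : num) : num :=
  nJ (nJ (nadd (nmul (qpos p) (cSucc (cPow2Pred n))) (qden p))
         (nmul (qneg p) (cSucc (cPow2Pred n))))
     (nadd (nmul (cL p) (cPow2Pred n)) (nadd (cL p) (cPow2Pred n))).

Ltac change_eqn :=
  unfold qeq; match goal with |- derives ?G ?A =>
    match eval cbv beta in A with fEq0 ?t ?u => change (eqn G t u) end end.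

(** The ends are fixed only up to [qeq]: the left ends of [real1] have numerator [P - 0], where
    [qminus q1] yields [(P+1) - 1], with [P = 2^n - 1]. *)
Definition approx (p : num) (x : fn) : form :=
  fAll0 (qeq (lo (x (nvar 0))) (qminus (nshift0 p) (nvar 0)) /\
         qeq (hi (x (nvar 0))) (qplus (nshift0 p) (nvar 0))).

Lemma subst_qeq n s q r :
  form_subst n s (qeq q r) = qeq (num_subst n s q) (num_subst n s r).
Proof. reflexivity. Qed.

Lemma subst_qminus n s p q :
  num_subst n s (qminus p q) = qminus (num_subst n s p) (num_subst n s q).
Proof. reflexivity. Qed.

Lemma subst_qplus n s p q :
  num_subst n s (qplus p q) = qplus (num_subst n s p) (num_subst n s q).
Proof. reflexivity. Qed.
#[local] Hint Rewrite subst_qeq subst_qminus subst_qplus : subst.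

Lemma subst_approx n s p x :
  form_subst n s (approx p x) = approx (num_subst n s p) (fn_subst s x).
Proof.
  unfold approx. cbn [form_subst].
  now rewrite !subst_qeq, subst_qminus, subst_qplus, up0_shift.
Qed.
#[local] Hint Rewrite subst_approx : subst.

Lemma qeq_le G q r : derives G (qeq q r) -> derives G (qle q r).
Proof. intros H. apply le_intro with nO. rewrite add_0_r. exact H. Qed.

Lemma qeq_ge G q r : derives G (qeq q r) -> derives G (qle r q).
Proof. intros H. apply le_intro with nO. rewrite add_0_r. symmetry. exact H. Qed.

Lemma qsub_mono G s s' t t' e :
  derives G (qle t' t) -> derives G (qle s s') ->
  derives G (qlt (qsub t s) e) -> derives G (qlt (qsub t' s') e).
Proof.
  intros Ht Hs H. apply qlt_cross.
  eapply (lt_linear G (nadd (nmul (cL t') (cL s')) (nadd (cL t') (cL s'))) num1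
    (nadd (nmul (cL t) (cL s)) (nadd (cL t) (cL s)))).
  - exact H.
  - set (S := nadd (cL s) num1). set (S' := nadd (cL s') num1).
    set (T := nadd (cL t) num1). set (T' := nadd (cL t') num1).
    set (E := nadd (cL e) num1).
    apply le_add; [exact (le_mul _ (nmul (nmul E S) S') _ _ Ht)
                  |exact (le_mul _ (nmul (nmul E T) T') _ _ Hs)].
  - fold (cross (qsub t s) e) (cross e (qsub t s)).
    rewrite !cross_expand. unfold qsub. unfold qpos, qneg, qden.
    rewrite !succ_add. repeat rewrite K_J. repeat rewrite L_J. nring.
Qed.

Ltac cross_ring :=
  rewrite ?cross_expand; unfold qsub, qpow2inv, qminus, qplus, qpos, qneg, qden;
  repeat rewrite pow2pred_S; rewrite ?succ_add;
  repeat rewrite K_J; repeat rewrite L_J; nring.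

Lemma qminus_lt G p n : derives G (qlt (qminus p n) p).
Proof.
  (* The two sides differ by [(c+1)^2] with [c = cL p], and [lt_intro] takes the difference less
     1. *)
  apply qlt_cross, lt_intro with (nadd (nmul (cL p) (cL p)) (nadd (cL p) (cL p))).
  cross_ring.
Qed.

Lemma lt_qplus G p n : derives G (qlt p (qplus p n)).
Proof.
  apply qlt_cross, lt_intro with (nadd (nmul (cL p) (cL p)) (nadd (cL p) (cL p))).
  cross_ring.
Qed.

Lemma qminus_step G p n : derives G (qlt (qminus p n) (qminus p (cSucc n))).
Proof.
  set (C := nadd (nmul (cL p) (cL p)) (nadd (cL p) (cL p))).
  set (P := cPow2Pred n).
  (* The gap [2^(-n-1)] times both denominators is [(C+1)(P+1)]. The witness is one less. *)
  apply qlt_cross, lt_intro with (nadd (nmul C P) (nadd C P)).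
  subst C P. cross_ring.
Qed.

Lemma qplus_step G p n : derives G (qlt (qplus p (cSucc n)) (qplus p n)).
Proof.
  set (C := nadd (nmul (cL p) (cL p)) (nadd (cL p) (cL p))).
  set (P := cPow2Pred n).
  apply qlt_cross, lt_intro with (nadd (nmul C P) (nadd C P)).
  subst C P. cross_ring.
Qed.

(** At index [m+2] the length is [2^(-m-1)]. Index [m+1] would give exactly [2^(-m)], where a strict
    inequality is required. *)
Lemma qplus_qminus_short G p m :
  derives G (qlt (qsub (qplus p (cSucc (cSucc m))) (qminus p (cSucc (cSucc m))))
                 (qpow2inv m)).
Proof.
  set (C := nadd (nmul (cL p) (cL p)) (nadd (cL p) (cL p))).
  set (P := cPow2Pred (cSucc (cSucc m))).
  set (M := cPow2Pred m).
  set (PM := nadd (nmul P M) (nadd P M)).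
  set (W := nadd (nmul C PM) (nadd C PM)).
  apply qlt_cross, lt_intro with (nadd (nadd W W) num1).
  subst C P M PM W. cross_ring.
Qed.

Lemma approx_lo G p x n : derives G (approx p x) ->
  derives G (qeq (lo (x n)) (qminus p n)).
Proof.
  intros H. apply (d_all0E _ _ n) in H. ssimpl_in H. now apply d_andE1 in H.
Qed.

Lemma approx_hi G p x n : derives G (approx p x) ->
  derives G (qeq (hi (x n)) (qplus p n)).
Proof.
  intros H. apply (d_all0E _ _ n) in H. ssimpl_in H. now apply d_andE2 in H.
Qed.

Lemma approx_lo_lt G p x n : derives G (approx p x) -> derives G (qlt (lo (x n)) p).
Proof.
  intros H. eapply qle_qlt_trans; [apply qeq_le, approx_lo, H|apply qminus_lt].
Qed.

Lemma lt_approx_hi G p x n : derives G (approx p x) -> derives G (qlt p (hi (x n))).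
Proof.
  intros H. eapply qlt_qle_trans; [apply lt_qplus|apply qeq_ge, approx_hi, H].
Qed.

Lemma approx_real G p x : derives G (approx p x) -> derives G (is_real x).
Proof.
  intros H. assert (S : forall n, derives G (qlt (lo (x n)) (hi (x n)))).
  { intro n. eapply qlt_trans; [apply approx_lo_lt|apply lt_approx_hi]; exact H. }
  apply d_andI; [|apply d_andI].
  - apply all0_intro. intro n. ssimpl. apply S.
  - apply all0_intro. intro n. ssimpl. apply d_andI; [|apply d_andI].
    + eapply qle_qlt_trans; [apply qeq_le, approx_lo, H|].
      eapply qlt_qle_trans; [apply qminus_step|apply qeq_ge, approx_lo, H].
    + apply S.
    + eapply qle_qlt_trans; [apply qeq_le, approx_hi, H|].
      eapply qlt_qle_trans; [apply qplus_step|apply qeq_ge, approx_hi, H].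
  - apply all0_intro. intro m. ssimpl. give0 (cSucc (cSucc m)).
    eapply qsub_mono; [apply qeq_le, approx_hi, H|apply qeq_ge, approx_lo, H|].
    apply qplus_qminus_short.
Qed.

Lemma approx_below G p q x : derives G (approx p x) -> derives G (qlt q p) ->
  derives G (fEx0 (qlt (nshift0 q) (lo (x (nvar 0))))).
Proof.
  intros H Hq. obtain0 n Hn from (real_compare _ x _ _ (approx_real _ _ _ H) Hq).
  cases Hn as K.
  - now give0 n.
  - apply qlt_asym with p (hi (x n)); trivial. now apply lt_approx_hi.
Qed.

Lemma approx_above G p r x : derives G (approx p x) -> derives G (qlt p r) ->
  derives G (fEx0 (qlt (hi (x (nvar 0))) (nshift0 r))).
Proof.
  intros H Hr. obtain0 n Hn from (real_compare _ x _ _ (approx_real _ _ _ H) Hr).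
  cases Hn as K.
  - apply qlt_asym with p (lo (x n)); trivial. now apply approx_lo_lt.
  - now give0 n.
Qed.

Definition q0 : num := nJ (nJ nO nO) nO.
Definition q1 : num := nJ (nJ num1 nO) nO.

Lemma qlt_0_1 G : derives G (qlt q0 q1).
Proof.
  apply qlt_cross, lt_intro with nO. unfold q0, q1. rewrite !cross_J. nring.
Qed.

Lemma approx_intro G p (x : fn) (l h : num -> num) :
  (forall n, eqn G (x n) (nJ (l n) (h n))) ->
  (forall n, derives G (qeq (l n) (qminus p n))) ->
  (forall n, derives G (qeq (h n) (qplus p n))) -> derives G (approx p x).
Proof.
  intros E Hl Hh. apply all0_intro. intro n. ssimpl. unfold lo, hi.
  apply d_andI; change_eqn; rewrite E, ?K_J, ?L_J; [apply Hl|apply Hh].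
Qed.

Lemma approx_real0 G : derives G (approx q0 real0).
Proof.
  apply approx_intro with
    (l := fun n => nJ (nJ nO num1) (cPow2Pred n))
    (h := fun n => nJ (nJ num1 nO) (cPow2Pred n)); intro n.
  - unfold real0. rewrite ev_correct. cbn [ev cRat cOne].
    rewrite (ev_correct G cPow2Pred n). reflexivity.
  - change_eqn. unfold q0. cross_ring.
  - change_eqn. unfold q0. cross_ring.
Qed.

Lemma approx_real1 G : derives G (approx q1 real1).
Proof.
  apply approx_intro with
    (l := fun n => nJ (nJ (cPow2Pred n) nO) (cPow2Pred n))
    (h := fun n => nJ (nJ (cSucc (cSucc (cPow2Pred n))) nO) (cPow2Pred n)); intro n.
  - unfold real1. rewrite ev_correct. cbn [ev cRat cOne].
    rewrite (ev_correct G cPow2Pred n). reflexivity.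
  - change_eqn. unfold q1. cross_ring.
  - change_eqn. unfold q1. cross_ring.
Qed.

Lemma real0_is_real G : derives G (is_real real0).
Proof. exact (approx_real _ _ _ (approx_real0 G)). Qed.

(** [rle real0 x] is a negation. Comparing [x] with some [q < 0] and with 0 turns it into a positive
    statement, since [x] cannot lie below 0. *)
Lemma nonneg_below G q x : derives G (is_real x) -> derives G (rle real0 x) ->
  derives G (qlt q q0) -> derives G (fEx0 (qlt (nshift0 q) (lo (x (nvar 0))))).
Proof.
  intros Hx H0 Hq. obtain0 n Hn from (real_compare _ x _ _ Hx Hq). cases Hn as K.
  - now give0 n.
  - obtain0 k Hk from (approx_below _ _ _ _ (approx_real0 _) K).
    apply d_botE. eapply d_impE; [exact H0|].
    exact (rlt_intro _ _ _ _ _ Hx (real0_is_real _) Hk).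
Qed.

Lemma real1_in_unit G : derives G (in_unit real1).
Proof.
  pose proof (approx_real0 G) as A0. pose proof (approx_real1 G) as A1.
  apply d_andI; [exact (approx_real _ _ _ A1)|apply d_andI].
  - assume H. obtain0 n Hn from H.
    apply qlt_asym with q0 q1; [apply qlt_0_1|].
    eapply qlt_trans; [eapply lt_approx_hi, A1|].
    eapply qlt_trans; [exact Hn|eapply approx_lo_lt, A0].
  - assume H. obtain0 n Hn from H. apply qlt_irrefl with q1.
    eapply qlt_trans; [eapply lt_approx_hi, A1|].
    eapply qlt_trans; [exact Hn|eapply approx_lo_lt, A1].
Qed.

(** * Functions obtained from the closure axioms *)

Lemma comp_exists G (f g : fn) :
  derives G (fEx1 (fAll0 (fvar 0 (nvar 0) == fshift1 f (fshift1 g (nvar 0))))).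
Proof.
  pose proof (d_all1E _ _ g (d_all1E G _ f (d_ax _ _ ax_cl_comp))) as K.
  now ssimpl_in K.
Qed.

Lemma comp2_exists G (f g h : fn) :
  derives G (fEx1 (fAll0
    (fvar 0 (nvar 0) == fshift1 f (nJ (fshift1 g (nvar 0)) (fshift1 h (nvar 0)))))).
Proof.
  pose proof (d_all1E _ _ h (d_all1E _ _ g (d_all1E G _ f (d_ax _ _ ax_cl_comp2)))) as K.
  now ssimpl_in K.
Qed.

Lemma rec_exists G (f g : fn) :
  derives G (fEx1 (fAll0 (fAll0
    (fvar 0 (nJ (nvar 1) nO) == fshift1 f (nvar 1) /\
     fvar 0 (nJ (nvar 1) (cSucc (nvar 0))) ==
     fshift1 g (nJ (nJ (nvar 1) (nvar 0)) (fvar 0 (nJ (nvar 1) (nvar 0)))))))).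
Proof.
  pose proof (d_all1E _ _ g (d_all1E G _ f (d_ax _ _ ax_cl_rec))) as K.
  now ssimpl_in K.
Qed.

(** Function terms contain no number variables, so the constant function with value [t] is not a
    term. Induction on [t] composes its predecessor with the successor. *)
Lemma const_exists G t :
  derives G (fEx1 (fAll0 (fvar 0 (nvar 0) == nshift0 (nshift1 t)))).
Proof.
  induct (fEx1 (fAll0 (fvar 0 (nvar 0) == nvar 1)))%bim at t as m IH.
  - give1 cZero. apply all0_intro. intro u. ssimpl. apply app_zero.
  - obtain1 f Hf from IH. obtain1 g Hg from (comp_exists _ cSucc f).
    give1 g. apply all0_intro. intro u. ssimpl.
    apply (d_all0E _ _ u) in Hf. apply (d_all0E _ _ u) in Hg.
    ssimpl_in Hf. ssimpl_in Hg. fold_eqn. now rewrite Hg, Hf.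
Qed.

(* [cApprox] maps J(p,n) to J(p - 2^(-n), p + 2^(-n)) *)
Definition cNum : con := cComp cK (cComp cK cK).
Definition cNeg : con := cComp cL (cComp cK cK).
Definition cDen : con := cComp cL cK.
Definition cPow : con := cComp cPow2Pred cL.
Definition cAddC (c d : con) : con := cComp cAdd (cPair c d).
Definition cMulC (c d : con) : con := cComp cMul (cPair c d).
Definition cApprox : con :=
  let den := cAddC (cMulC cDen cPow) (cAddC cDen cPow) in
  let a := cMulC cNum (cComp cSucc cPow) in
  let b := cMulC cNeg (cComp cSucc cPow) in
  let d := cComp cSucc cDen in
  cPair (cPair (cPair a (cAddC b d)) den) (cPair (cPair (cAddC a d) b) den).

Lemma cApprox_eqn G p n : eqn G (cApprox (nJ p n)) (nJ (qminus p n) (qplus p n)).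
Proof.
  transitivity (cApprox (nJ (nJ (nJ (qpos p) (qneg p)) (cL p)) n)).
  - now rewrite <- rat_eta.
  - rewrite ev_correct. unfold qminus, qplus. rewrite (ev_correct G cPow2Pred n).
    reflexivity.
Qed.

Lemma rational_exists G p : derives G (fEx1 (approx (nshift1 p) (fvar 0))).
Proof.
  obtain1 c Hc from (const_exists G p).
  obtain1 x Hx from (comp2_exists _ cApprox c cId).
  give1 x. apply approx_intro with (l := qminus p) (h := qplus p).
  - intro n. apply (d_all0E _ _ n) in Hc. apply (d_all0E _ _ n) in Hx.
    ssimpl_in Hc. ssimpl_in Hx. fold_eqn. now rewrite Hx, Hc, app_id, cApprox_eqn.
  - intro n. change_eqn. reflexivity.
  - intro n. change_eqn. reflexivity.
Qed.

(** * A characteristic function for the order of the rationals *)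

Definition cPred : con :=
  cComp (cRec cZero (cComp cL cK)) (cPair cZero cId).
Definition cMonus : con := cRec cId (cComp cPred cL).
Definition monus (t u : num) : num := cMonus (nJ t u).

Lemma pred_0 G : eqn G (cPred nO) nO.
Proof.
  unfold cPred. rewrite app_comp, (ev_correct G (cPair _ _)); cbn [ev].
  rewrite rec_0. apply app_zero.
Qed.

Lemma pred_S G t : eqn G (cPred (cSucc t)) t.
Proof.
  unfold cPred. rewrite app_comp, (ev_correct G (cPair _ _)); cbn [ev].
  rewrite rec_S, (ev_correct G (cComp _ _)). reflexivity.
Qed.

Lemma monus_0 G t : eqn G (monus t nO) t.
Proof. unfold monus, cMonus. rewrite rec_0. apply app_id. Qed.

Lemma monus_S G t u : eqn G (monus t (cSucc u)) (cPred (monus t u)).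
Proof. unfold monus, cMonus. now rewrite rec_S, app_comp, L_J. Qed.

#[local] Instance monus_proper G :
  Morphisms.Proper (Morphisms.respectful (eqn G) (Morphisms.respectful (eqn G) (eqn G)))
    monus.
Proof. intros t u H t' u' H'. unfold monus. now rewrite H, H'. Qed.

Lemma subst_monus n s t u :
  num_subst n s (monus t u) = monus (num_subst n s t) (num_subst n s u).
Proof. reflexivity. Qed.
#[local] Hint Rewrite subst_monus : subst.

Lemma monus_S_S G t u : eqn G (monus (cSucc t) (cSucc u)) (monus t u).
Proof.
  induct (monus (cSucc (nshift0 t)) (cSucc (nvar 0)) == monus (nshift0 t) (nvar 0))%bim
    at u as m IH.
  - now rewrite monus_S, !monus_0, pred_S.
  - now rewrite monus_S, IH, <- monus_S.
Qed.

Lemma monus_add_l G t d : eqn G (monus (nadd t d) t) d.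
Proof.
  induct (monus (nadd (nvar 0) (nshift0 d)) (nvar 0) == nshift0 d)%bim at t as m IH.
  - now rewrite monus_0, add_0_l.
  - now rewrite add_S_l, monus_S_S.
Qed.

Lemma monus_add_r G t d : eqn G (monus t (nadd t d)) nO.
Proof.
  induct (monus (nshift0 t) (nadd (nshift0 t) (nvar 0)) == nO)%bim at d as m IH.
  - rewrite add_0_r. rewrite <- (add_0_r G t) at 1. apply monus_add_l.
  - now rewrite add_S_r, monus_S, IH, pred_0.
Qed.

Lemma lt_monus G t u : derives G (fLt t u) -> derives G (~ (monus u t == nO)).
Proof.
  intros H. assume K. gap d E from H.
  rewrite <- E, monus_add_l, <- succ_add in K. now apply succ_neq0 with d.
Qed.

Lemma monus_lt G t u : derives G (~ (monus u t == nO)) -> derives G (fLt t u).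
Proof.
  intros H. cases (lt_or_le G t u) as K; trivial. gap d E from K.
  apply d_botE. eapply d_impE; [exact H|]. fold_eqn. rewrite <- E. apply monus_add_r.
Qed.

Definition cCross (c d : con) : con :=
  cAddC (cMulC (cComp cK (cComp cK c)) (cComp cSucc (cComp cL d)))
        (cMulC (cComp cL (cComp cK d)) (cComp cSucc (cComp cL c))).
(** The truncated difference of the two cross products, non-zero exactly when the first rational is
    below the second. *)
Definition cQlt : con := cComp cMonus (cPair (cCross cL cK) (cCross cK cL)).

Lemma cQlt_eqn G q r : eqn G (cQlt (nJ q r)) (monus (cross r q) (cross q r)).
Proof.
  rewrite (rat_eta G q), (rat_eta G r), ev_correct, !cross_J, <- !succ_add.
  reflexivity.
Qed.

Lemma qlt_char G q r : derives G (qlt q r) -> derives G (~ (cQlt (nJ q r) == nO)).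
Proof.
  intros H. apply lt_monus in H. assume K.
  eapply d_impE; [exact H|]. fold_eqn. rewrite cQlt_eqn in K. exact K.
Qed.

Lemma char_qlt G q r : derives G (~ (cQlt (nJ q r) == nO)) -> derives G (qlt q r).
Proof.
  intros H. apply monus_lt. assume K. eapply d_impE; [exact H|]. fold_eqn.
  rewrite cQlt_eqn. exact K.
Qed.

Lemma nonzero_elim G t C : derives G (~ (t == nO)) ->
  (forall D d, incl G D -> eqn D t (cSucc d) -> derives D C) -> derives G C.
Proof.
  intros H HC. eapply or_elim; [exact (zero_or_succ G t)| |]; intros D I K.
  - apply d_botE. eapply d_impE; [exact (derives_weaken _ _ _ H I)|exact K].
  - eapply ex0_elim; [exact K|]. intros D' d I' E. ssimpl_in E.
    apply (HC D' d); [eapply incl_tran; eassumption|exact E].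
Qed.

Lemma nonzero_mul G t u : derives G (~ (t == nO)) -> derives G (~ (u == nO)) ->
  derives G (~ (nmul t u == nO)).
Proof.
  intros H H'. assume K.
  eapply nonzero_elim; [exact H|]. intros D1 d I E. enter I.
  eapply nonzero_elim; [exact H'|]. intros D2 d' I E'. enter I.
  rewrite E, E', mul_S_r, add_S_l in K. exact (succ_neq0 _ _ _ K).
Qed.

Lemma nonzero_mul_l G t u : derives G (~ (nmul t u == nO)) -> derives G (~ (t == nO)).
Proof.
  intros H. assume K. eapply d_impE; [exact H|]. fold_eqn. now rewrite K, mul_0_l.
Qed.

Lemma nonzero_mul_r G t u : derives G (~ (nmul t u == nO)) -> derives G (~ (u == nO)).
Proof.
  intros H. assume K. eapply d_impE; [exact H|]. fold_eqn. now rewrite K, mul_0_r.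
Qed.

(** Case distinction by recursion on [c]: the base returns the second component of the parameter and
    each step returns the first, so [sel c t u] is [u] for [c = 0] and [t] otherwise. *)
Definition cSel : con := cRec cL (cComp cK (cComp cK cK)).
Definition sel (c t u : num) : num := cSel (nJ (nJ t u) c).

#[local] Instance sel_proper G :
  Morphisms.Proper (Morphisms.respectful (eqn G) (Morphisms.respectful (eqn G)
    (Morphisms.respectful (eqn G) (eqn G)))) sel.
Proof. intros c c' Hc t t' Ht u u' Hu. unfold sel. now rewrite Hc, Ht, Hu. Qed.

Lemma sel_0 G t u : eqn G (sel nO t u) u.
Proof. unfold sel, cSel. now rewrite rec_0, L_J. Qed.

Lemma sel_S G c t u : eqn G (sel (cSucc c) t u) t.
Proof. unfold sel, cSel. rewrite rec_S, ev_correct. reflexivity. Qed.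

(** * Finite sequences *)

Definition drop (t i : num) : num := cDrop (nJ t i).

#[local] Instance drop_proper G :
  Morphisms.Proper (Morphisms.respectful (eqn G) (Morphisms.respectful (eqn G) (eqn G)))
    drop.
Proof. intros t u H t' u' H'. unfold drop. now rewrite H, H'. Qed.

Lemma subst_drop n s t u :
  num_subst n s (drop t u) = drop (num_subst n s t) (num_subst n s u).
Proof. reflexivity. Qed.
#[local] Hint Rewrite subst_drop : subst.

Lemma drop_0 G t : eqn G (drop t nO) t.
Proof. unfold drop, cDrop. rewrite rec_0. apply app_id. Qed.

Lemma drop_S G t i : eqn G (drop t (cSucc i)) (cL (drop t i)).
Proof. unfold drop, cDrop. now rewrite rec_S, app_comp, L_J. Qed.

Lemma drop_tail G t i : eqn G (drop t (cSucc i)) (drop (cL t) i).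
Proof.
  induct (drop (nshift0 t) (cSucc (nvar 0)) == drop (cL (nshift0 t)) (nvar 0))%bim at i as m IH.
  - now rewrite drop_S, !drop_0.
  - now rewrite drop_S, IH, <- drop_S.
Qed.

(** [v] is [w] cut to its first [n] entries and followed by [e]. The first clause makes [v] end in
    0, as [is_code] asks of the body of a code. *)
Definition appended (v w n e : num) : form :=
  fAnd (drop v (cSucc n) == nO)
    (fAnd (cK (drop v n) == e)
       (fAll0 (fLt (nvar 0) (nshift0 n) ==>
               cK (drop (nshift0 v) (nvar 0)) == cK (drop (nshift0 w) (nvar 0))))).

Lemma subst_appended n s v w m e :
  form_subst n s (appended v w m e) =
  appended (num_subst n s v) (num_subst n s w) (num_subst n s m) (num_subst n s e).
Proof.
  unfold appended. cbn [form_subst num_subst fn_subst up0].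
  now rewrite !subst_drop, subst_fLt, !up0_shift.
Qed.
#[local] Hint Rewrite subst_appended : subst.

Lemma lt_0_r G t A : derives G (fLt t nO) -> derives G A.
Proof.
  intros H. gap d E from H. rewrite add_assoc, <- succ_add in E.
  exact (succ_neq0 _ _ _ E).
Qed.

Lemma lt_S_S G t u : derives G (fLt (cSucc t) (cSucc u)) -> derives G (fLt t u).
Proof.
  intros H. gap d E from H. apply lt_intro with d. apply succ_inj.
  now rewrite <- add_S_l.
Qed.

Lemma lt_succ_cases G t u : derives G (fLt t (cSucc u)) ->
  derives G (fLt t u \/ t == u).
Proof.
  intros H. gap d E from H. rewrite <- succ_add, add_S_r in E. apply succ_inj in E.
  cases (zero_or_succ _ d) as Hd.
  - apply d_orI2. fold_eqn. now rewrite <- E, Hd, add_0_r.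
  - obtain0 c Hc from Hd. apply d_orI1, lt_intro with c. now rewrite <- E, Hc, succ_add.
Qed.

Lemma append_exists G w n e :
  derives G (fEx0 (appended (nvar 0) (nshift0 w) (nshift0 n) (nshift0 e))).
Proof.
  (* The claim is generalised over [w], because the induction step is applied to its tail. *)
  assert (H : derives G (fAll0 (fEx0
    (appended (nvar 0) (nvar 1) (nshift0 (nshift0 n)) (nshift0 (nshift0 e)))))).
  { induct (fAll0 (fEx0
      (appended (nvar 0) (nvar 1) (nvar 2) (nshift0 (nshift0 (nshift0 e))))))%bim at n as m IH.
    - apply all0_intro. intro u. ssimpl. give0 (nJ e nO).
      apply d_andI; [|apply d_andI]; fold_eqn.
      + now rewrite drop_S, drop_0, L_J.
      + now rewrite drop_0, K_J.
      + apply all0_intro. intro i. ssimpl. assume Hi. exact (lt_0_r _ _ _ Hi).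
    - apply all0_intro. intro u. ssimpl.
      apply (d_all0E _ _ (cL u)) in IH. ssimpl_in IH. obtain0 v Hv from IH.
      pose proof (d_andE1 _ _ _ Hv) as H1. apply d_andE2 in Hv.
      pose proof (d_andE1 _ _ _ Hv) as H2. apply d_andE2 in Hv. fold_eqn.
      give0 (nJ (cK u) v). apply d_andI; [|apply d_andI]; fold_eqn.
      + now rewrite drop_tail, L_J.
      + now rewrite drop_tail, L_J.
      + apply all0_intro. intro i. ssimpl. assume Hi.
        cases (zero_or_succ _ i) as Ei; fold_eqn.
        * now rewrite Ei, !drop_0, K_J.
        * obtain0 j Hj from Ei.
          pose proof (lt_S_S _ j m (lt_eqn _ _ _ _ _ Hj (reflexivity (cSucc m)) Hi))
            as Hlt.
          apply (d_all0E _ _ j) in Hv. ssimpl_in Hv.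
          pose proof (d_impE _ _ _ Hv Hlt) as K. fold_eqn.
          now rewrite Hj, !drop_tail, L_J. }
  apply (d_all0E _ _ w) in H. now ssimpl_in H.
Qed.

Lemma initial_exists G a m :
  derives G (fEx0 (is_initial a (nshift0 m) (nvar 0))).
Proof.
  (* The induction builds the body of the code, appending [a k] at stage [k]. The length is put in
     front afterwards. *)
  assert (H : derives G (fEx0 (drop (nvar 0) (nshift0 m) == nO /\
    fAll0 (fLt (nvar 0) (nshift0 (nshift0 m)) ==>
           cK (drop (nvar 1) (nvar 0)) == a (nvar 0))))).
  { induct (fEx0 (drop (nvar 0) (nvar 1) == nO /\
      fAll0 (fLt (nvar 0) (nvar 2) ==>
             cK (drop (nvar 1) (nvar 0)) == a (nvar 0))))%bim at m as k IH.
    - give0 nO. apply d_andI; fold_eqn; [apply drop_0|].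
      apply all0_intro. intro i. ssimpl. assume Hi. exact (lt_0_r _ _ _ Hi).
    - obtain0 b Hb from IH. obtain0 v Hv from (append_exists _ b k (a k)).
      pose proof (d_andE1 _ _ _ Hv) as H1. apply d_andE2 in Hv.
      pose proof (d_andE1 _ _ _ Hv) as H2. apply d_andE2 in Hv. fold_eqn.
      apply d_andE2 in Hb. give0 v. apply d_andI; fold_eqn; [exact H1|].
      apply all0_intro. intro i. ssimpl. assume Hi.
      cases (lt_succ_cases _ _ _ Hi) as K; fold_eqn.
      + apply (d_all0E _ _ i) in Hv. ssimpl_in Hv.
        apply (d_all0E _ _ i) in Hb. ssimpl_in Hb.
        pose proof (d_impE _ _ _ Hv K) as Kv. pose proof (d_impE _ _ _ Hb K) as Kb.
        fold_eqn. now rewrite Kv.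
      + now rewrite K. }
  obtain0 b Hb from H. pose proof (d_andE1 _ _ _ Hb) as H1. apply d_andE2 in Hb.
  fold_eqn. give0 (nJ m b). unfold is_initial, is_code, entry, seq_length.
  cbn [form_subst num_subst fn_subst up0]. ssimpl.
  apply d_andI; [|apply d_andI]; fold_eqn.
  - now rewrite L_J, K_J.
  - apply K_J.
  - apply all0_intro. intro i. ssimpl. assume Hi.
    apply (d_all0E _ _ i) in Hb. ssimpl_in Hb.
    pose proof (d_impE _ _ _ Hb Hi) as K. fold_eqn. now rewrite L_J.
Qed.

(** * Chains of segments *)

(** The product of the three tests is non-zero when all of them succeed. Otherwise [r] stays where
    it is, so arbitrary numbers [w] and [n] describe a chain and no well-formedness condition is
    needed. *)
Definition step (a : fn) (e r : num) : num :=
  sel (nmul (a e) (nmul (cQlt (nJ (lo e) (hi e))) (cQlt (nJ (lo e) r)))) (hi e) r.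

(* [g] at J(w,n) is the right end reached from 0 by running through the first [n]
   entries of [w], each entry [e] moving the point [r] to the right end of [e] when
   [e] is a segment enumerated by [a] whose left end lies below [r] *)
Definition reach (a g : fn) : form :=
  fAll0 (fAll0 (g (nJ (nvar 1) nO) == q0 /\
    g (nJ (nvar 1) (cSucc (nvar 0))) ==
    step a (cK (drop (nvar 1) (nvar 0))) (g (nJ (nvar 1) (nvar 0))))).

Lemma subst_step n s a e r :
  num_subst n s (step a e r) =
  step (fn_subst s a) (num_subst n s e) (num_subst n s r).
Proof. reflexivity. Qed.

Lemma subst_reach n s a g :
  form_subst n s (reach a g) = reach (fn_subst s a) (fn_subst s g).
Proof. reflexivity. Qed.
#[local] Hint Rewrite subst_step subst_reach : subst.

#[local] Instance step_proper G a :
  Morphisms.Proper (Morphisms.respectful (eqn G) (Morphisms.respectful (eqn G) (eqn G)))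
    (step a).
Proof. intros t u H t' u' H'. unfold step, lo, hi. now rewrite H, H'. Qed.

Lemma reach_exists G a : derives G (fEx1 (reach (fshift1 a) (fvar 0))).
Proof.
  (* The recursion step receives [z = J(J(w,n),r)], from which [cE] reads the entry of [w] at [n]. A
     constant cannot mention [a], so [cStep] acts on [J(a(e),z)], with the value of [a] computed
     beforehand by [f]. *)
  set (cE := cComp cK (cComp cDrop cK)).
  set (e := cComp cE cL). set (r := cComp cL cL).
  set (lt := fun c d => cComp cQlt (cPair c d)).
  set (cStep := cComp cSel (cPair (cPair (cComp cL e) r)
    (cMulC cK (cMulC (lt (cComp cK e) (cComp cL e)) (lt (cComp cK e) r))))).
  obtain1 f Hf from (comp_exists G a cE).
  obtain1 h Hh from (comp2_exists _ cStep f cId).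
  obtain1 g Hg from (rec_exists _ (cPair (cPair cZero cZero) cZero) h).
  give1 g. apply all0_intro. intro w. apply all0_intro. intro n. ssimpl.
  apply (d_all0E _ _ w) in Hg. apply (d_all0E _ _ n) in Hg. ssimpl_in Hg.
  pose proof (d_andE1 _ _ _ Hg) as H0. apply d_andE2 in Hg.
  set (z := nJ (nJ w n) (g (nJ w n))) in *.
  apply (d_all0E _ _ z) in Hf. apply (d_all0E _ _ z) in Hh.
  ssimpl_in Hf. ssimpl_in Hh. fold_eqn.
  apply d_andI; fold_eqn.
  - rewrite H0, ev_correct. reflexivity.
  - rewrite Hg, Hh, Hf, app_id, !(ev_correct _ cE), ev_correct.
    unfold step. rewrite !(ev_correct _ cQlt). reflexivity.
Qed.

Lemma reach_0 G a g w : derives G (reach a g) -> eqn G (g (nJ w nO)) q0.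
Proof.
  intros H. apply (d_all0E _ _ w) in H. apply (d_all0E _ _ nO) in H. ssimpl_in H.
  now apply d_andE1 in H.
Qed.

Lemma reach_S G a g w n : derives G (reach a g) ->
  eqn G (g (nJ w (cSucc n))) (step a (cK (drop w n)) (g (nJ w n))).
Proof.
  intros H. apply (d_all0E _ _ w) in H. apply (d_all0E _ _ n) in H. ssimpl_in H.
  now apply d_andE2 in H.
Qed.

Definition usable (a : fn) (e r : num) : form :=
  fAnd (~ (a e == nO)) (fAnd (is_segment e) (qlt (lo e) r)).

Lemma step_usable G a e r : derives G (usable a e r) -> eqn G (step a e r) (hi e).
Proof.
  intros H. pose proof (d_andE1 _ _ _ H) as H1. apply d_andE2 in H.
  pose proof (d_andE1 _ _ _ H) as H2. apply d_andE2 in H.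
  eapply nonzero_elim;
    [exact (nonzero_mul _ _ _ H1
             (nonzero_mul _ _ _ (qlt_char _ _ _ H2) (qlt_char _ _ _ H)))|].
  intros D d I E. fold_eqn. unfold step. rewrite E. apply sel_S.
Qed.

Lemma step_cases G a e r :
  derives G (step a e r == r \/ (usable a e r /\ step a e r == hi e)).
Proof.
  cases (zero_or_succ G
    (nmul (a e) (nmul (cQlt (nJ (lo e) (hi e))) (cQlt (nJ (lo e) r))))) as H.
  - apply d_orI1. fold_eqn. unfold step. rewrite H. apply sel_0.
  - obtain0 d Hd from H. apply d_orI2.
    assert (N : derives D0 (~ (nmul (a e)
      (nmul (cQlt (nJ (lo e) (hi e))) (cQlt (nJ (lo e) r))) == nO))).
    { assume K. rewrite Hd in K. exact (succ_neq0 _ _ _ K). }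
    assert (U : derives D0 (usable a e r)).
    { apply d_andI; [exact (nonzero_mul_l _ _ _ N)|]. apply nonzero_mul_r in N.
      apply d_andI; apply char_qlt;
        [exact (nonzero_mul_l _ _ _ N)|exact (nonzero_mul_r _ _ _ N)]. }
    apply d_andI; [exact U|]. exact (step_usable _ _ _ _ U).
Qed.

(** The point reached after [k] entries is determined by these entries. Stated as an implication so
    that [k <= n] takes part in the induction. *)
Lemma reach_agree G a g v w n k : derives G (reach a g) ->
  derives G (fAll0 (fLt (nvar 0) (nshift0 n) ==>
    cK (drop (nshift0 v) (nvar 0)) == cK (drop (nshift0 w) (nvar 0)))) ->
  derives G (fLe k n ==> g (nJ v k) == g (nJ w k)).
Proof.
  intros Hg Hv.
  induct (fLe (nvar 0) (nshift0 n) ==>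
          g (nJ (nshift0 v) (nvar 0)) == g (nJ (nshift0 w) (nvar 0)))%bim at k as m IH.
  - assume H. now rewrite !(reach_0 _ _ _ _ Hg).
  - assume H. gap d E from H.
    apply (d_all0E _ _ m) in Hv. ssimpl_in Hv.
    rewrite add_S_l, <- add_S_r, succ_add in E.
    pose proof (d_impE _ _ _ Hv (lt_intro _ _ _ _ E)) as Em.
    pose proof (d_impE _ _ _ IH (le_intro _ _ _ _ E)) as Eg. fold_eqn.
    now rewrite !(reach_S _ _ _ _ _ Hg), Em, Eg.
Qed.

Lemma reach_append G a g w n e : derives G (reach a g) ->
  derives G (usable a e (g (nJ w n))) ->
  derives G (fEx0 (g (nJ (nvar 0) (cSucc (nshift0 n))) == hi (nshift0 e))).
Proof.
  intros Hg Hu. obtain0 v Hv from (append_exists _ w n e).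
  pose proof (d_andE1 _ _ _ (d_andE2 _ _ _ Hv)) as He.
  apply d_andE2, d_andE2 in Hv.
  pose proof (d_impE _ _ _ (reach_agree _ _ _ _ _ _ n Hg Hv)
    (le_intro _ _ _ _ (add_0_r _ n))) as E.
  give0 v. fold_eqn. rewrite (reach_S _ _ _ _ _ Hg), He, E.
  now apply step_usable.
Qed.

(** * Finite covers *)

(** The condition of [in_Hfin] with the values of [a] below [m] in place of a code of them, so that
    codes of sequences enter only at the end. *)
Definition covered (a x : fn) (m : num) : form :=
  fEx0 (fEx0 (fAnd (fLt (nvar 0) (nshift0 (nshift0 m)))
    (fAnd (is_segment (nvar 0)) (fAnd (~ (a (nvar 0) == nO))
      (strictly_inside (x (nvar 1)) (nvar 0)))))).

Lemma subst_covered n s a x m :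
  form_subst n s (covered a x m) =
  covered (fn_subst s a) (fn_subst s x) (num_subst n s m).
Proof.
  unfold covered. cbn [form_subst num_subst fn_subst up0].
  now rewrite subst_fLt, !up0_shift, subst_is_segment, subst_strictly_inside.
Qed.
#[local] Hint Rewrite subst_covered : subst.

(* the nonnegative reals either are covered by the segments with codes below [m] or
   exceed every rational below [r] *)
Definition covers (a : fn) (r m : num) : form :=
  fAll1 (is_real (fvar 0) ==> rle real0 (fvar 0) ==>
    fAll0 (qlt (nvar 0) (nshift0 (nshift1 r)) ==>
      covered (fshift1 a) (fvar 0) (nshift0 (nshift1 m)) \/
      fEx0 (qlt (nvar 1) (lo (fvar 0 (nvar 0)))))).

Lemma subst_covers n s a r m :
  form_subst n s (covers a r m) =
  covers (fn_subst s a) (num_subst n s r) (num_subst n s m).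
Proof.
  unfold covers. cbn [form_subst num_subst fn_subst up0 up1].
  now rewrite subst_is_real, subst_rle, !subst_qlt, subst_covered, !up0_shift,
    !up1_shift, up1_fshift.
Qed.
#[local] Hint Rewrite subst_covers : subst.

Lemma covers_intro G a r m :
  (forall D x q, incl G D -> derives D (is_real x) -> derives D (rle real0 x) ->
    derives D (qlt q r) ->
    derives D (covered a x m \/ fEx0 (qlt (nshift0 q) (lo (x (nvar 0)))))) ->
  derives G (covers a r m).
Proof.
  intros H. apply all1_intro. intro x. ssimpl.
  apply imp_intro. intros D1 I1 Hx. apply imp_intro. intros D2 I2 H0.
  apply all0_intro. intro q. ssimpl. apply imp_intro. intros D3 I3 Hq.
  apply H; trivial.
  - eapply incl_tran; [exact I1|]. now apply incl_tran with D2.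
  - apply derives_weaken with D2; trivial. now apply derives_weaken with D1.
  - now apply derives_weaken with D2.
Qed.

Lemma covers_elim G a r m x q : derives G (covers a r m) ->
  derives G (is_real x) -> derives G (rle real0 x) -> derives G (qlt q r) ->
  derives G (covered a x m \/ fEx0 (qlt (nshift0 q) (lo (x (nvar 0))))).
Proof.
  intros H Hx H0 Hq. apply (d_all1E _ _ x) in H. ssimpl_in H.
  pose proof (d_impE _ _ _ (d_impE _ _ _ H Hx) H0) as K.
  apply (d_all0E _ _ q) in K. ssimpl_in K. exact (d_impE _ _ _ K Hq).
Qed.

Lemma covered_intro G (a x : fn) m k s :
  derives G (fLt s m) -> derives G (is_segment s) -> derives G (~ (a s == nO)) ->
  derives G (strictly_inside (x k) s) -> derives G (covered a x m).
Proof.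
  intros Hm Hs Ha Hi. give0 k. give0 s.
  apply d_andI; [exact Hm|apply d_andI; [exact Hs|apply d_andI; [exact Ha|exact Hi]]].
Qed.

Lemma covered_mono G a x m m' :
  derives G (fLe m m') -> derives G (covered a x m) -> derives G (covered a x m').
Proof.
  intros Hm H. obtain0 k H1 from H. obtain0 s H2 from H1.
  apply covered_intro with k s.
  - gap d E from Hm. pose proof (d_andE1 _ _ _ H2) as H3. gap c E' from H3.
    apply lt_intro with (nadd c d). rewrite <- E, <- E'. nring.
  - exact (d_andE1 _ _ _ (d_andE2 _ _ _ H2)).
  - exact (d_andE1 _ _ _ (d_andE2 _ _ _ (d_andE2 _ _ _ H2))).
  - exact (d_andE2 _ _ _ (d_andE2 _ _ _ (d_andE2 _ _ _ H2))).
Qed.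

Lemma covers_eqn G a r r' m :
  eqn G r r' -> derives G (covers a r m) -> derives G (covers a r' m).
Proof.
  intros E H. apply covers_intro. intros D x q I Hx H0 Hq. enter I.
  apply covers_elim with r; trivial. revert Hq.
  apply qlt_eqn; [reflexivity|now symmetry].
Qed.

Lemma covers_0 G a : derives G (covers a q0 nO).
Proof.
  apply covers_intro. intros D x q I Hx H0 Hq. apply d_orI2.
  now apply nonneg_below.
Qed.

(** As [lo e < r], a nonnegative real is already covered or exceeds [lo e]. In the second case
    comparison with [q < hi e] leaves it above [q] or inside [e]. The new bound lies above [e] and
    is at least [m]. *)
Lemma covers_usable G a r m e :
  derives G (usable a e r) -> derives G (covers a r m) ->
  derives G (covers a (hi e) (nadd m (nadd e num1))).
Proof.
  intros He H. apply covers_intro. intros D x q I Hx H0 Hq. enter I.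
  pose proof (d_andE1 _ _ _ He) as Ha. apply d_andE2 in He.
  pose proof (d_andE1 _ _ _ He) as Hs. apply d_andE2 in He.
  cases (covers_elim _ _ _ _ _ _ H Hx H0 He) as K.
  - apply d_orI1. revert K. apply covered_mono, le_add_r.
  - obtain0 k Hk from K. obtain0 k' Hk' from (real_compare _ _ _ _ Hx Hq).
    cases Hk' as C.
    + apply d_orI2. now give0 k'.
    + apply d_orI1. apply covered_intro with (nadd k k') e; trivial.
      * apply lt_intro with m. nring.
      * apply d_andI; [|apply d_andI].
        -- eapply real_lo_mono; [exact Hx|apply le_add_r|exact Hk].
        -- now apply real_segment.
        -- eapply real_hi_mono; [exact Hx|apply le_add_l|exact C].
Qed.

(** Induction along the chain, starting with no segment at 0. An entry that does not move the point
    leaves the bound unchanged. *)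
Lemma reach_covers G a (g : fn) w n : derives G (reach a g) ->
  derives G (fEx0 (covers a (g (nJ (nshift0 w) (nshift0 n))) (nvar 0))).
Proof.
  intros Hg.
  induct (fEx0 (covers a (g (nJ (nshift0 (nshift0 w)) (nvar 1))) (nvar 0)))
    at n as k IH.
  - give0 nO. apply covers_eqn with q0; [symmetry; now apply reach_0 with a|].
    apply covers_0.
  - obtain0 m Hm from IH.
    pose proof (reach_S _ _ _ w k Hg) as E. symmetry in E.
    cases (step_cases _ a (cK (drop w k)) (g (nJ w k))) as C.
    + give0 m. apply covers_eqn with (g (nJ w k)); trivial. fold_eqn.
      now rewrite <- E, C.
    + pose proof (d_andE1 _ _ _ C) as Hu. apply d_andE2 in C.
      give0 (nadd m (nadd (cK (drop w k)) num1)).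
      apply covers_eqn with (hi (cK (drop w k))); [fold_eqn; now rewrite <- E, C|].
      now apply covers_usable with (g (nJ w k)).
Qed.

(** * The open set of reached points *)

(* [b] enumerates the segments whose right end is below the point reached along the
   chain that is hidden in the code of the left end *)
Definition reached (g b : fn) : form :=
  fAll0 (b (nvar 0) == cQlt (nJ (hi (nvar 0)) (g (qpos (lo (nvar 0)))))).

Lemma subst_reached n s g b :
  form_subst n s (reached g b) = reached (fn_subst s g) (fn_subst s b).
Proof. reflexivity. Qed.
#[local] Hint Rewrite subst_reached : subst.

Lemma reached_exists G g : derives G (fEx1 (reached (fshift1 g) (fvar 0))).
Proof.
  obtain1 h Hh from (comp_exists G g (cComp cK (cComp cK cK))).
  obtain1 b Hb from (comp2_exists _ cQlt cL h).
  give1 b. apply all0_intro. intro s. ssimpl.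
  apply (d_all0E _ _ s) in Hh. apply (d_all0E _ _ s) in Hb.
  ssimpl_in Hh. ssimpl_in Hb. fold_eqn.
  unfold qpos, lo, hi. now rewrite Hb, Hh, !app_comp.
Qed.

Lemma reached_char G (g b : fn) s : derives G (reached g b) ->
  eqn G (b s) (cQlt (nJ (hi s) (g (qpos (lo s))))).
Proof. intros H. apply (d_all0E _ _ s) in H. now ssimpl_in H. Qed.

Lemma reached_elim G (g b : fn) s : derives G (reached g b) -> derives G (~ (b s == nO)) ->
  derives G (qlt (hi s) (g (qpos (lo s)))).
Proof.
  intros Hb H. apply char_qlt. assume K. eapply d_impE; [exact H|]. fold_eqn.
  now rewrite (reached_char _ _ _ _ Hb).
Qed.

(* the integer [-(qneg q + 1)], coded with [v] as its positive part *)
Definition tagged (v q : num) : num :=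
  nJ (nJ v (nadd v (nadd (qneg q) num1))) nO.

Lemma qpos_tagged G v q : eqn G (qpos (tagged v q)) v.
Proof. unfold qpos, tagged. now rewrite !K_J. Qed.

Lemma tagged_lt G v q : derives G (qlt (tagged v q) q).
Proof.
  apply qlt_cross, lt_intro with
    (nadd (qpos q) (nadd (nmul (qneg q) (cL q)) (cL q))).
  unfold tagged. cross_ring.
Qed.

Lemma reached_intro G (g b x : fn) n v : derives G (reached g b) -> derives G (is_real x) ->
  derives G (qlt (hi (x n)) (g v)) -> derives G (in_H b x).
Proof.
  intros Hb Hx Hv.
  (* The left end is a negative integer below the segment [x (n+1)] that carries [v] as its positive
     part. The right end is that of [x n], so it is the next segment [x (n+1)] that lies strictly
     inside [s]. *)
  set (s := nJ (tagged v (lo (x (cSucc n)))) (hi (x n))).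
  assert (El : eqn G (tagged v (lo (x (cSucc n)))) (lo s)).
  { unfold s, lo at 2. now rewrite K_J. }
  assert (Eh : eqn G (hi (x n)) (hi s)).
  { unfold s, hi at 2. now rewrite L_J. }
  assert (I : derives G (strictly_inside (x (cSucc n)) s)).
  { pose proof (real_inside _ _ n Hx) as J. apply d_andI; [|apply d_andI].
    - apply qlt_eqn with (tagged v (lo (x (cSucc n)))) (lo (x (cSucc n)));
        [exact El|reflexivity|apply tagged_lt].
    - exact (d_andE1 _ _ _ (d_andE2 _ _ _ J)).
    - apply qlt_eqn with (hi (x (cSucc n))) (hi (x n));
        [reflexivity|exact Eh|exact (d_andE2 _ _ _ (d_andE2 _ _ _ J))]. }
  apply d_andI; [exact Hx|]. give0 (cSucc n). give0 s.
  apply d_andI; [|apply d_andI].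
  - eapply qlt_trans; [exact (d_andE1 _ _ _ I)|].
    eapply qlt_trans; [exact (d_andE1 _ _ _ (d_andE2 _ _ _ I))|].
    exact (d_andE2 _ _ _ (d_andE2 _ _ _ I)).
  - apply qlt_char in Hv. assume K. eapply d_impE; [exact Hv|]. fold_eqn.
    rewrite <- K, (reached_char _ _ _ _ Hb), <- Eh, <- El, qpos_tagged. reflexivity.
  - exact I.
Qed.

Lemma in_H_elim G (a x : fn) C : derives G (in_H a x) ->
  (forall D n s, incl G D -> derives D (is_segment s) -> derives D (~ (a s == nO)) ->
    derives D (strictly_inside (x n) s) -> derives D C) -> derives G C.
Proof.
  intros H HC. apply d_andE2 in H.
  eapply ex0_elim; [exact H|]. intros D1 n I1 H1. ssimpl_in H1.
  eapply ex0_elim; [exact H1|]. intros D2 s I2 H2. ssimpl_in H2.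
  apply (HC D2 n s).
  - eapply incl_tran; eassumption.
  - exact (d_andE1 _ _ _ H2).
  - exact (d_andE1 _ _ _ (d_andE2 _ _ _ H2)).
  - exact (d_andE2 _ _ _ (d_andE2 _ _ _ H2)).
Qed.

(** For [q < 0] the empty chain will do. Otherwise the left end [p > q] of a segment of [c], taken
    as a real, lies in [[0,c)]. The hypothesis puts it into the open set of [b], and the segment
    found there hides a chain that passes [p]. *)
Lemma reach_beyond G (a g b c : fn) q : derives G (reach a g) -> derives G (reached g b) ->
  derives G (is_real c) -> derives G (rle real0 c) ->
  derives G (fAll1 (is_real (fvar 0) ==> rle real0 (fvar 0) ==>
    rlt (fvar 0) (fshift1 c) ==> in_H (fshift1 b) (fvar 0))) ->
  derives G (fEx0 (qlt (nshift0 q) (lo (c (nvar 0))))) ->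
  derives G (fEx0 (fEx0 (qlt (nshift0 (nshift0 q)) (g (nJ (nvar 1) (nvar 0)))))).
Proof.
  intros Hg Hb Hc H0 H Hq. obtain0 n Hn from Hq.
  cases (qlt_or_qle _ q q0) as Q.
  - give0 nO. give0 nO. revert Q. apply qlt_eqn; [reflexivity|].
    symmetry. now apply reach_0 with a.
  - set (p := lo (c n)) in *.
    obtain1 d Hd from (rational_exists _ p).
    pose proof (approx_real _ _ _ Hd) as Rd.
    assert (Hp : derives D (qlt p (lo (c (cSucc n))))).
    { exact (d_andE1 _ _ _ (real_inside _ _ n Hc)). }
    obtain0 k Hk from (approx_above _ _ _ _ Hd Hp).
    apply (d_all1E _ _ d) in H. ssimpl_in H.
    assert (L0 : derives D0 (rle real0 d)).
    { assume K. obtain0 j Hj from K. apply qlt_irrefl with p.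
      eapply qlt_trans; [apply lt_approx_hi, Hd|].
      eapply qlt_trans; [exact Hj|].
      eapply qlt_trans; [apply approx_lo_lt, approx_real0|].
      eapply qle_qlt_trans; [exact Q|exact Hn]. }
    pose proof (d_impE _ _ _ (d_impE _ _ _ (d_impE _ _ _ H Rd) L0)
      (rlt_intro _ _ _ _ _ Rd Hc Hk)) as K.
    eapply in_H_elim; [exact K|]. intros D' j s I Hs Hbs Hi. enter I.
    (* Pairing is surjective, so the hidden number splits into a sequence and a length. *)
    give0 (cK (qpos (lo s))). give0 (cL (qpos (lo s))).
    apply qlt_eqn with q (g (qpos (lo s))); [reflexivity|now rewrite J_K_L|].
    eapply qlt_trans; [exact Hn|].
    eapply qlt_trans; [apply lt_approx_hi, Hd|].
    eapply qlt_trans; [exact (d_andE2 _ _ _ (d_andE2 _ _ _ Hi))|].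
    now apply reached_elim with b.
Qed.

Lemma reached_progressive G a g b c : derives G (reach a g) -> derives G (reached g b) ->
  derives G (in_unit c) -> derives G (in_H a c) ->
  derives G (fAll1 (is_real (fvar 0) ==> rle real0 (fvar 0) ==>
    rlt (fvar 0) (fshift1 c) ==> in_H (fshift1 b) (fvar 0))) ->
  derives G (in_H b c).
Proof.
  intros Hg Hb Hu Hc H.
  eapply in_H_elim; [exact Hc|]. intros D n e I Hs Ha Hi. enter I. clear Hc.
  pose proof (d_andE1 _ _ _ Hu) as Rc.
  pose proof (d_andE1 _ _ _ (d_andE2 _ _ _ Hu)) as L0.
  assert (Q : derives D (fEx0 (qlt (nshift0 (lo e)) (lo (c (nvar 0)))))).
  { give0 n. exact (d_andE1 _ _ _ Hi). }
  obtain0 w K from (reach_beyond _ _ _ _ _ _ Hg Hb Rc L0 H Q).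
  obtain0 k Hk from K.
  assert (U : derives D (usable a e (g (nJ w k)))).
  { apply d_andI; [exact Ha|now apply d_andI]. }
  obtain0 v Hv from (reach_append _ _ _ _ _ _ Hg U). fold_eqn.
  (* [c n] lies strictly inside [e], so the prolonged chain, which reaches [hi e], passes the right
     end of [c n]. *)
  apply reached_intro with g n (nJ v (cSucc k)); trivial.
  apply qlt_eqn with (hi (c n)) (hi e); [reflexivity|now symmetry|].
  exact (d_andE2 _ _ _ (d_andE2 _ _ _ Hi)).
Qed.

(** * From a chain that passes 1 to a finite cover *)

Lemma covered_in_Hfin G a m t x : derives G (is_real x) ->
  derives G (is_initial a m t) -> derives G (covered a x m) ->
  derives G (in_Hfin t x).
Proof.
  intros Hx Ht H. obtain0 n H1 from H. obtain0 s H2 from H1.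
  pose proof (d_andE1 _ _ _ (d_andE2 _ _ _ Ht)) as El. fold_eqn.
  pose proof (d_andE2 _ _ _ (d_andE2 _ _ _ Ht)) as Ee.
  pose proof (d_andE1 _ _ _ H2) as Hm. apply d_andE2 in H2.
  apply (d_all0E _ _ s) in Ee. ssimpl_in Ee. rewrite subst_entry in Ee.
  ssimpl_in Ee.
  pose proof (d_impE _ _ _ Ee Hm) as E. fold_eqn.
  apply d_andI; [exact Hx|]. give0 n. give0 s.
  rewrite ?subst_entry, ?subst_seq_length. ssimpl.
  apply d_andI; [|apply d_andI; [|apply d_andI]].
  - revert Hm. apply lt_eqn; [reflexivity|now symmetry].
  - exact (d_andE1 _ _ _ H2).
  - assume K. eapply d_impE; [exact (d_andE1 _ _ _ (d_andE2 _ _ _ H2))|]. fold_eqn.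
    now rewrite <- E, K.
  - exact (d_andE2 _ _ _ (d_andE2 _ _ _ H2)).
Qed.

Lemma subst_is_initial n s a m t :
  form_subst n s (is_initial a m t) =
  is_initial (fn_subst s a) (num_subst n s m) (num_subst n s t).
Proof.
  unfold is_initial, is_code. cbn [form_subst num_subst fn_subst up0].
  now rewrite subst_fLt, subst_entry, !up0_shift.
Qed.

Lemma subst_in_Hfin n s t x :
  form_subst n s (in_Hfin t x) = in_Hfin (num_subst n s t) (fn_subst s x).
Proof.
  unfold in_Hfin. cbn [form_subst num_subst fn_subst up0].
  now rewrite subst_is_real, subst_fLt, subst_is_segment, subst_entry,
    subst_seq_length, subst_strictly_inside, !up0_shift.
Qed.

Lemma subst_unit_sub_Hfin n s t :
  form_subst n s (unit_sub_Hfin t) = unit_sub_Hfin (num_subst n s t).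
Proof.
  unfold unit_sub_Hfin. cbn [form_subst fn_subst up1].
  now rewrite subst_in_unit, subst_in_Hfin, up1_shift.
Qed.
#[local] Hint Rewrite subst_is_initial subst_in_Hfin
  subst_unit_sub_Hfin : subst.

Lemma unit_sub_H_elim G (a x : fn) : derives G (unit_sub_H a) ->
  derives G (in_unit x) -> derives G (in_H a x).
Proof.
  intros H Hx. apply (d_all1E _ _ x) in H. ssimpl_in H. exact (d_impE _ _ _ H Hx).
Qed.

Lemma open_induction G (b : fn) : derives G OI ->
  (forall D c, incl G D -> derives D (in_unit c) ->
    derives D (fAll1 (is_real (fvar 0) ==> rle real0 (fvar 0) ==>
      rlt (fvar 0) (fshift1 c) ==> in_H (fshift1 b) (fvar 0))) ->
    derives D (in_H b c)) ->
  derives G (unit_sub_H b).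
Proof.
  intros H Hb. apply (d_all1E _ _ b) in H. unfold unit_sub_H in H. ssimpl_in H.
  eapply d_impE; [exact H|]. apply all1_intro. intro c. ssimpl.
  apply imp_intro. intros D1 I1 Hc. apply imp_intro. intros D2 I2 Hi.
  apply Hb; [now apply incl_tran with D1|now apply derives_weaken with D1|exact Hi].
Qed.

(** Take the right end of [real1 n] as the rational below [r]. A real of the unit interval cannot
    exceed it, as it would then exceed 1. *)
Lemma covers_unit G (a x : fn) r m n : derives G (covers a r m) ->
  derives G (qlt (hi (real1 n)) r) -> derives G (in_unit x) ->
  derives G (covered a x m).
Proof.
  intros H Hr Hx.
  cases (covers_elim _ _ _ _ _ _ H (d_andE1 _ _ _ Hx)
    (d_andE1 _ _ _ (d_andE2 _ _ _ Hx)) Hr) as K; trivial.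
  obtain0 k Hk from K. apply d_botE.
  eapply d_impE; [exact (d_andE2 _ _ _ (d_andE2 _ _ _ Hx))|].
  eapply rlt_intro; [eapply approx_real, approx_real1|exact (d_andE1 _ _ _ Hx)|exact Hk].
Qed.

Theorem theorem4p2 : BIM_proves (OI ==> HB)%bim.
Proof.
  apply imp_intro. intros G _ HOI. apply all1_intro. intro a. ssimpl. assume Ha.
  obtain1 g Hg from (reach_exists _ a).
  obtain1 b Hb from (reached_exists _ g).
  match goal with |- derives ?D _ => assert (Ho : derives D (unit_sub_H b)) end.
  { apply open_induction; trivial. intros D' c I Hc H. enter I.
    apply reached_progressive with a g; trivial. now apply unit_sub_H_elim. }
  (* Open induction is evaluated at 1: the segment [s] of [b] around [real1 n] hides in its left end
     a chain whose last point exceeds [hi (real1 n)]. *)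
  eapply in_H_elim; [exact (unit_sub_H_elim _ _ _ Ho (real1_in_unit _))|].
  intros D' n s I _ Hs Hi. enter I.
  obtain0 m Hm from (reach_covers _ _ _ (cK (qpos (lo s))) (cL (qpos (lo s))) Hg).
  obtain0 t Ht from (initial_exists _ a m).
  give0 m. give0 t. apply d_andI; [exact Ht|].
  apply all1_intro. intro x. ssimpl. assume Hx.
  apply covered_in_Hfin with a m; [exact (d_andE1 _ _ _ Hx)|exact Ht|].
  eapply covers_unit; [exact Hm| |exact Hx].
  apply qlt_eqn with (hi (real1 n)) (g (qpos (lo s))); [reflexivity|now rewrite J_K_L|].
  eapply qlt_trans; [exact (d_andE2 _ _ _ (d_andE2 _ _ _ Hi))|].
  now apply reached_elim with b.
Qed.
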